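(* Let $\phi$ be a normalized Drinfeld module of rank $1$ with period lattice $\rho_I I$, where $I<A$ is a nonzero ideal and $\rho_I\in\mathbb{C}_\infty^\times$, and let $\phi^*:A\to\mathbb{C}_\infty[\tau^{-1}]$ denote the adjoint Drinfeld module. Then for all $a\in A$: \[\phi^*_a\left((\rho_I^{-1}\otimes1)\zeta_I\right)=(1\otimes a)(\rho_I^{-1}\otimes1)\zeta_I.\]
   Context: Setting. $X$ is a projective, geometrically irreducible, smooth curve of genus $g$ over the finite field $\mathbb{F}_q$, and $\infty\in X(\mathbb{F}_q)$. $A$ is the ring of regular functions on $X\setminus\{\infty\}$, $K=\operatorname{Frac}(A)$, $K_\infty$ is the completion of $K$ at $\infty$, $\mathbb{C}_\infty$ is the completion of an algebraic closure of $K_\infty$. $I<A$ means that $I$ is an ideal of $A$. $\deg$ on $K$ is minus the valuation at $\infty$. Unlabeled tensor products are over $\mathbb{F}_q$; $\mathbb{C}_\infty\hat\otimes A$ is the completion of $\mathbb{C}_\infty\otimes A$ for the sup norm ($\|\sum c_i\otimes b_i\|=\max|c_i|$ for an $\mathbb{F}_q$-basis $(b_i)$ of $A$). Sign. Fix a uniformizer $w\in K$ at $\infty\in X$; for $a\in A\setminus\{0\}$, $\operatorname{sgn}(a)\in\mathbb{F}_q^\times$ is the leading coefficient of $a$ in $\mathbb{F}_q((w))$. Drinfeld modules. $\mathbb{C}_\infty[\tau]$ and $\mathbb{C}_\infty[\tau^{-1}]$ are the rings of noncommutative polynomials with $\tau c=c^q\tau$ and $\tau^{-1}c^q=c\tau^{-1}$.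 A normalized Drinfeld module of rank $1$ is a ring homomorphism $\phi:A\to\mathbb{C}_\infty[\tau]$, $a\mapsto\phi_a=\sum_i a_i\tau^i$, such that for all $a\ne0$: $\deg_\tau\phi_a=\deg a$, $a_0=a$ and $a_{\deg a}=\operatorname{sgn}(a)$. Its period lattice is the unique discrete rank-$1$ $A$-submodule $\Lambda\subseteq\mathbb{C}_\infty$ such that $\exp_\Lambda(x)=x\prod_{\lambda\in\Lambda\setminus\{0\}}(1-x/\lambda)$ satisfies $\exp_\Lambda(ax)=\phi_a(\exp_\Lambda(x))$ for all $a\in A$. The adjoint of $\phi$ is $\phi^*_a:=\sum_i\tau^{-i}a_i=\sum_i a_i^{1/q^i}\tau^{-i}$. $\mathbb{C}_\infty[\tau^{-1}]$ acts on $\mathbb{C}_\infty\hat\otimes A$: $\tau^{-1}$ acts as the continuous $A$-linear extension of $c\mapsto c^{1/q}$ and $c\in\mathbb{C}_\infty$ acts as multiplication by $c\otimes1$. Zeta function. $\zeta_I:=\sum_{a\in I\setminus\{0\}}a^{-1}\otimes a\in\mathbb{C}_\infty\hat\otimes A$. *)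

(* Defs.v *)
From HB Require Import structures.
From mathcomp Require Import all_boot all_order all_algebra.
From mathcomp Require Import closed_field finmap boolp classical_sets reals.
From mathcomp Require Import mpoly.
Set Implicit Arguments.
Unset Strict Implicit.
Unset Printing Implicit Defensive.
Import Order.TTheory GRing.Theory Num.Theory.
Local Open Scope classical_set_scope.
Local Open Scope ring_scope.

Definition Fbar (F : finFieldType) : countClosedFieldType :=
  projT1 (countable_algebraic_closure F).

Definition to_Fbar (F : finFieldType) : {rmorphism F -> Fbar F} :=
  sval (projT2 (countable_algebraic_closure F)).

(* A nonempty closed integral subscheme of P^n over F, given by homogeneous
   equations which generate a prime ideal other than the irrelevant one. *)
Record projective_variety (F : finFieldType) := ProjectiveVariety {
  ambient : nat;
  neqs : nat;
  eqs : 'I_neqs -> {mpoly F[ambient.+1]};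
  eqs_homog : forall j, exists d, eqs j \is d.-homog;
  vanishing : set {mpoly F[ambient.+1]} :=
    [set f | exists c : 'I_neqs -> {mpoly F[ambient.+1]},
       f = \sum_(j < neqs) c j * eqs j];
  vanishing_proper : ~ vanishing 1;
  vanishing_prime : forall f g,
    vanishing (f * g) -> vanishing f \/ vanishing g;
  vanishing_relevant : exists i, ~ vanishing 'X_i }.

Section Geometry.
Variables (F : finFieldType) (X : projective_variety F).
Local Notation n := (ambient X).

(* Points are given by homogeneous coordinates. *)
Definition geometric_point (x : 'I_n.+1 -> Fbar F) : Prop :=
  (exists i, x i != 0) /\ forall j, mmap (to_Fbar F) x (eqs j) = 0.

Definition same_point (x y : 'I_n.+1 -> Fbar F) : Prop :=
  exists2 c : Fbar F, c != 0 & forall i, y i = c * x i.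

Definition homogeneous_set (S : set {mpoly (Fbar F)[n.+1]}) : Prop :=
  forall f, S f -> exists d, f \is d.-homog.

Definition zero_locus (S : set {mpoly (Fbar F)[n.+1]}) :
    set ('I_n.+1 -> Fbar F) :=
  [set x | forall f, S f -> f.@[x] = 0].

Definition geometrically_irreducible : Prop :=
  (exists x, geometric_point x) /\
  forall S1 S2, homogeneous_set S1 -> homogeneous_set S2 ->
    geometric_point `<=` zero_locus S1 `|` zero_locus S2 ->
    geometric_point `<=` zero_locus S1 \/ geometric_point `<=` zero_locus S2.

(* The Jacobian criterion in homogeneous coordinates: X is smooth of relative
   dimension d iff the Jacobian matrix of its equations has rank n - d at each
   geometric point. *)
Definition smooth_of_dim (d : nat) : Prop :=
  forall x, geometric_point x ->
    (\rank (\matrix_(j < neqs X, i < n.+1)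
              mmap (to_Fbar F) x (mderiv i (eqs j))) + d = n)%N.

(* The function field, as a field with a generic point: its elements are the
   fractions of homogeneous forms of the same degree, modulo the ideal of X. *)
Record function_field := FunctionField {
  ff_sort :> fieldType;
  ff_const : {rmorphism F -> ff_sort};
  generic_point : 'I_n.+1 -> ff_sort;
  generic_pointP : forall d (f : {mpoly F[n.+1]}), f \is d.-homog ->
    mmap ff_const generic_point f = 0 <-> vanishing f;
  ff_fracP : forall y : ff_sort, exists d (g h : {mpoly F[n.+1]}),
    [/\ g \is d.-homog, h \is d.-homog, mmap ff_const generic_point h != 0 &
        y = mmap ff_const generic_point g / mmap ff_const generic_point h] }.

Variable K : function_field.
Local Notation xi := (generic_point K).

(* The dimension of X is the transcendence degree of K over F. *)
Definition one_dimensional : Prop :=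
  exists t : K, ~ algebraicOver (ff_const K) t /\
    forall y : K, exists2 p : {poly {poly F}}, p != 0 &
      (map_poly (fun c => (map_poly (ff_const K) c).[t]) p).[y] = 0.

Definition regular_at (x : 'I_n.+1 -> Fbar F) (y : K) : Prop :=
  exists d (g h : {mpoly F[n.+1]}),
    [/\ g \is d.-homog, h \is d.-homog, mmap (to_Fbar F) x h != 0,
        mmap (ff_const K) xi h != 0 &
        y = mmap (ff_const K) xi g / mmap (ff_const K) xi h].

Record rational_point := RationalPoint {
  rp_coord : 'I_n.+1 -> F;
  rp_neq0 : exists i, rp_coord i != 0;
  rp_on : forall j, (eqs j).@[rp_coord] = 0 }.

Definition rp_geom (P : rational_point) : 'I_n.+1 -> Fbar F :=
  fun i => to_Fbar F (rp_coord P i).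

Variable oo : rational_point.

Definition regular_away (y : K) : Prop :=
  forall x, geometric_point x -> ~ same_point (rp_geom oo) x -> regular_at x y.

Definition regular_away_pred : {pred K} := fun y => `[< regular_away y >].

Lemma regular_at_const x c : regular_at x (ff_const K c).
Proof.
exists 0%N, (c *: 1), 1; split.
- exact/dhomogZ/dhomog1.
- exact: dhomog1.
- by rewrite rmorph1 oner_neq0.
- by rewrite rmorph1 oner_neq0.
- by rewrite mmapZ rmorph1 divr1 mulr1.
Qed.

Lemma regular_atB x y z :
  regular_at x y -> regular_at x z -> regular_at x (y - z).
Proof.
move=> [d [g [h [hg hh xh kh ->]]]] [e [g' [h' [hg' hh' xh' kh' ->]]]].
exists (d + e)%N, (g * h' - g' * h), (h * h'); split.
- by apply: rpredB; [|rewrite addnC]; apply: dhomogM.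
- exact: dhomogM.
- by rewrite rmorphM mulf_neq0.
- by rewrite rmorphM mulf_neq0.
- by rewrite -[in LHS]mulNr addf_div // mulNr rmorphB !rmorphM.
Qed.

Lemma regular_atM x y z :
  regular_at x y -> regular_at x z -> regular_at x (y * z).
Proof.
move=> [d [g [h [hg hh xh kh ->]]]] [e [g' [h' [hg' hh' xh' kh' ->]]]].
exists (d + e)%N, (g * g'), (h * h'); split; try exact: dhomogM.
- by rewrite rmorphM mulf_neq0.
- by rewrite rmorphM mulf_neq0.
- by rewrite !rmorphM /= mulf_div.
Qed.

Lemma regular_away_const c : ff_const K c \in regular_away_pred.
Proof. by apply/asboolP => x _ _; exact: regular_at_const. Qed.

Lemma regular_away_subring : subring_closed regular_away_pred.
Proof.
split.
- by rewrite -(rmorph1 (ff_const K)); exact: regular_away_const.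
- move=> y z /asboolP hy /asboolP hz; apply/asboolP => x hx nx.
  by apply: regular_atB; [apply: hy | apply: hz].
- move=> y z /asboolP hy /asboolP hz; apply/asboolP => x hx nx.
  by apply: regular_atM; [apply: hy | apply: hz].
Qed.

HB.instance Definition _ :=
  GRing.isSubringClosed.Build K regular_away_pred regular_away_subring.

Record affine_ring := AffineRing {
  ar_val :> K;
  ar_valP : ar_val \in regular_away_pred }.

HB.instance Definition _ := [isSub for ar_val].
HB.instance Definition _ := [Choice of affine_ring by <:].
HB.instance Definition _ := [SubChoice_isSubComNzRing of affine_ring by <:].

Definition ar_const (c : F) : affine_ring := AffineRing (regular_away_const c).

(* v is the normalized valuation of K at oo; its value at 0 is irrelevant. *)
Definition valuation_at (v : K -> int) : Prop :=
  [/\ forall x y, x != 0 -> y != 0 -> v (x * y) = v x + v y,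
      forall x y, x != 0 -> y != 0 -> x + y != 0 ->
        Num.min (v x) (v y) <= v (x + y),
      exists2 x, x != 0 & v x = 1 &
      forall x, x != 0 -> (0 <= v x <-> regular_at (rp_geom oo) x)].

Definition uniformizer (v : K -> int) (w : K) : Prop := w != 0 /\ v w = 1.

(* s is the coefficient c_0 in the expansion y = sum_(i >= 0) c_i w^(m+i),
   with c_0 nonzero, of y in F((w)). *)
Definition leading_coefficient (v : K -> int) (w y : K) (s : F) : Prop :=
  s != 0 /\ exists (m : int) (c : nat -> F), c 0%N = s /\
    forall N : nat,
      let r := y - \sum_(i < N) ff_const K (c i) * w ^ (m + i%:Z) in
      r = 0 \/ m + N%:Z <= v r.

Definition ar_deg (v : K -> int) (a : affine_ring) : int := - v (ar_val a).

(* |x| = q^(deg x) *)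
Definition absK (R : realType) (v : K -> int) (x : K) : R :=
  if x == 0 then 0 else #|F|%:R ^ (- v x).

End Geometry.

Definition is_ideal (A : comNzRingType) (I : set A) : Prop :=
  [/\ I 0, forall x y, I x -> I y -> I (x + y) &
      forall a x, I x -> I (a * x)].

Section Ultrametric.
Variable R : realType.

Definition ultrametric (V : zmodType) (N : V -> R) : Prop :=
  (forall x, N x = 0 <-> x = 0) /\
  forall x y, N (x - y) <= Num.max (N x) (N y).

Definition absolute_value (L : fieldType) (N : L -> R) : Prop :=
  ultrametric N /\ forall x y, N (x * y) = N x * N y.

Definition complete_for (V : zmodType) (N : V -> R) : Prop :=
  forall u : nat -> V,
    (forall e, 0 < e -> exists M, forall m n, (M <= m)%N -> (M <= n)%N ->
       N (u m - u n) < e) ->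
    exists l, forall e, 0 < e -> exists M, forall n, (M <= n)%N ->
       N (u n - l) < e.

Record completion (L : fieldType) (N : L -> R) := Completion {
  cpl_sort :> fieldType;
  cpl_norm : cpl_sort -> R;
  cpl_in : {rmorphism L -> cpl_sort};
  cpl_abs : absolute_value cpl_norm;
  cpl_isometry : forall x, cpl_norm (cpl_in x) = N x;
  cpl_dense : forall y e, 0 < e -> exists x, cpl_norm (y - cpl_in x) < e;
  cpl_complete : complete_for cpl_norm }.

Record algebraic_closure (L : fieldType) (N : L -> R) := AlgebraicClosure {
  ac_sort :> closedFieldType;
  ac_norm : ac_sort -> R;
  ac_in : {rmorphism L -> ac_sort};
  ac_abs : absolute_value ac_norm;
  ac_extends : forall x, ac_norm (ac_in x) = N x;
  ac_algebraic : forall y, algebraicOver ac_in y }.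

#[global] Arguments cpl_norm {L N} c _.
#[global] Arguments ac_norm {L N} a _.

Definition tower_in (L : fieldType) (N : L -> R) (L1 : completion N)
    (L2 : algebraic_closure (cpl_norm L1)) (L3 : completion (ac_norm L2)) :
    L -> L3 :=
  fun x => cpl_in L3 (ac_in L2 (cpl_in L1 x)).

(* The limit of f along the finite subsets of S, ordered by inclusion; it is 0
   when there is no limit. *)
Definition finset_lim (V : zmodType) (N : V -> R) (I : choiceType) (S : set I)
    (f : {fset I} -> V) : V :=
  xget 0 [set l | forall e, 0 < e ->
    exists2 J0 : {fset I}, [set` J0] `<=` S &
      forall J : {fset I}, [set` J] `<=` S -> (J0 `<=` J)%fset ->
        N (f J - l) < e].

Definition infinite_sum (V : zmodType) (N : V -> R) (I : choiceType)
    (S : set I) (g : I -> V) : V :=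
  finset_lim N S (fun J => \sum_(i <- enum_fset J) g i).

Definition infinite_prod (L : fieldType) (N : L -> R) (I : choiceType)
    (S : set I) (g : I -> L) : L :=
  finset_lim N S (fun J => \prod_(i <- enum_fset J) g i).

End Ultrametric.

Section Drinfeld.
Variables (R : realType) (q : nat) (C : fieldType) (N : C -> R).
Variables (A : comNzRingType) (j : A -> C).

(* {poly C} represents both C[tau] and C[tau^-1]: f stands for
   sum_i f_i tau^i, respectively sum_i f_i tau^-i.  Only the additive structure
   of {poly C} is the right one; the product of C[tau] is the following. *)
Definition tau_mul (f g : {poly C}) : {poly C} :=
  \sum_(i < size f) \sum_(k < size g)
    (f`_i * g`_k ^+ (q ^ i)) *: 'X^(i + k).

Definition tau_eval (f : {poly C}) (x : C) : C :=
  \sum_(i < size f) f`_i * x ^+ (q ^ i).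

Definition tau_morphism (phi : A -> {poly C}) : Prop :=
  [/\ phi 1 = 1, forall a b, phi (a + b) = phi a + phi b &
      forall a b, phi (a * b) = tau_mul (phi a) (phi b)].

Definition normalized_drinfeld (deg : A -> int) (sgn : A -> C)
    (phi : A -> {poly C}) : Prop :=
  tau_morphism phi /\
  forall a, a != 0 ->
    [/\ (size (phi a))%:Z = deg a + 1,
        (phi a)`_0 = j a &
        (phi a)`_`|deg a|%N = sgn a].

Definition exp_lattice (L : set C) (x : C) : C :=
  x * infinite_prod N [set l | L l /\ l != 0] (fun l => 1 - x / l).

Definition submodule (L : set C) : Prop :=
  [/\ L 0, forall x y, L x -> L y -> L (x + y) &
      forall a x, L x -> L (j a * x)].

Definition discrete (L : set C) : Prop :=
  forall x, L x -> exists2 e : R, 0 < e &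
    forall y, L y -> N (y - x) < e -> y = x.

Definition rank_one (L : set C) : Prop :=
  (exists2 x, L x & x != 0) /\
  forall x y, L x -> L y ->
    exists a b, (a, b) != (0, 0) /\ j a * x + j b * y = 0.

Definition period_lattice (phi : A -> {poly C}) (L : set C) : Prop :=
  [/\ submodule L, discrete L, rank_one L &
      forall a x, exp_lattice L (j a * x) = tau_eval (phi a) (exp_lattice L x)].

(* c^(1/q): the q-th root is unique when q is a power of the characteristic. *)
Definition qroot (c : C) : C := xget 0 [set y | y ^+ q = c].

(* sum_i tau^-i a_i = sum_i a_i^(1/q^i) tau^-i *)
Definition adjoint (f : {poly C}) : {poly C} :=
  \poly_(i < size f) iter i qroot f`_i.

End Drinfeld.

(* A complete normed ring containing the tensor product of C and A as a dense
   subring, on which the norm is the sup norm.  Since each finite F-free family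
   extends to a basis, the sup norm is prescribed on all finite F-free families
   of A. *)
Record completed_tensor (R : realType) (F C : fieldType) (N : C -> R)
    (A : comNzRingType) (cC : F -> C) (cA : F -> A) := CompletedTensor {
  ct_sort :> comNzRingType;
  ct_norm : ct_sort -> R;
  ct_left : {rmorphism C -> ct_sort};
  ct_right : {rmorphism A -> ct_sort};
  ct_balanced : forall c, ct_left (cC c) = ct_right (cA c);
  ct_ultrametric : ultrametric ct_norm;
  ct_normM : forall x y, ct_norm (x * y) <= ct_norm x * ct_norm y;
  ct_sup_norm : forall (m : nat) (b : 'I_m -> A) (c : 'I_m -> C),
    (forall k : 'I_m -> F, \sum_(i < m) cA (k i) * b i = 0 ->
       forall i, k i = 0) ->
    ct_norm (\sum_(i < m) ct_left (c i) * ct_right (b i)) =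
      \big[Num.max/0]_(i < m) N (c i);
  ct_dense : forall x e, 0 < e ->
    exists (m : nat) (c : 'I_m -> C) (b : 'I_m -> A),
      ct_norm (x - \sum_(i < m) ct_left (c i) * ct_right (b i)) < e;
  ct_complete : complete_for ct_norm }.

Arguments ct_norm {R F C N A cC cA} _ _.

Section Action.
Variables (R : realType) (q : nat) (F C : fieldType) (N : C -> R).
Variables (A : comNzRingType) (j : A -> C) (cC : F -> C) (cA : F -> A).
Variable T : completed_tensor N cC cA.

Definition tensor (c : C) (a : A) : T := ct_left T c * ct_right T a.

(* t is the continuous A-linear extension of c |-> c^(1/q). *)
Definition tau_inv (t : T -> T) : Prop :=
  [/\ forall x y, t (x + y) = t x + t y,
      forall a x, t (tensor 1 a * x) = tensor 1 a * t x,
      forall c, t (tensor c 1) = tensor (qroot q c) 1 &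
      forall x e, 0 < e -> exists2 d, 0 < d &
        forall y, ct_norm T (y - x) < d -> ct_norm T (t y - t x) < e].

Definition tau_inv_act (t : T -> T) (f : {poly C}) (x : T) : T :=
  \sum_(i < size f) tensor f`_i 1 * iter i t x.

Definition zeta (I : set A) : T :=
  infinite_sum (ct_norm T) [set a | I a /\ a != 0]
    (fun a => tensor (j a)^-1 a).

End Action.

(* Main.v *)
From HB Require Import structures.
Require Import Defs.
From mathcomp Require Import all_boot all_order all_algebra.
From mathcomp Require Import all_fingroup all_solvable all_field.
From mathcomp Require Import finmap boolp classical_sets reals.
From mathcomp Require Import zify ring.
Set Implicit Arguments.
Unset Strict Implicit.
Unset Printing Implicit Defensive.
Import Order.TTheory GRing.Theory Num.Theory.
Local Open Scope classical_set_scope.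
Local Open Scope ring_scope.

(** Write q for the cardinality of F, tau for the Frobenius x |-> x^q, and
    l b = rho * b for the points of the period lattice.

    Everything comes from an identity about finite spaces.  For a finite
    F-subspace V of A put
      E_V(y) = y * prod_(v in V \ 0) (1 - y / l v),
      Z_V    = sum_(v in V \ 0) (l v)^-1 (x) v.
    If V is a hyperplane of U = V + F x and h = E_V(l x), then
      E_U = (1 - h^(1-q) tau) E_V                         [expV]
      Z_V = (1 - tau^-1 h^(1-q)) Z_U                      [zetaV_step]
    and the operator in the second line is the adjoint of the operator in the
    first.  By composition, whenever V lies in U and E_U = P E_V with P in
    C[tau], the adjoint P^* maps Z_U to Z_V  [expV_quot, zetaV_quot].

    The reason for the second line is duality.  The polynomial g_V of
    tau-degree less than dim V which takes the value 1 (x) v at each l v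
    [interp] is, up to sign, the numerator in the partial fraction
    sum_v (1 (x) v) / (y + l v) = - g_V(y) / E_V(y), so that its linear
    coefficient is - Z_V.  As (tau - 1) g_V vanishes on V, where tau acts on
    the coefficients in C only, it is a multiple of E_V, namely Z_V E_V
    [tV_interp].  The terms of Z_U outside Z_V come from the same partial
    fraction at the points y = c (l x), and tau^-1 applied to the relation
    (tau - 1) g_V = Z_V E_V at y = l x turns them into the second line.

    Now exhaust I by the finite spaces V_n of the elements of pole order at
    most n + const.  They are finite since Lambda is discrete and each pole
    order contributes at most one dimension, by leading coefficients.  If a has
    degree d then a V_n lies in V_(n+d) with codimension at most d, so that
      E_(V_(n+d))(a y) = P_n(E_(V_n)(y)),   P_n^*(Z_(V_(n+d))) = (1 (x) a) Z_(V_n)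
    with P_n of tau-degree at most d  [filtration_quotient].  As n grows,
    E_(V_n) tends pointwise to the exponential of the lattice and Z_(V_n) to
    (rho^-1 (x) 1) zeta_I.  Since P_n has bounded degree and its values at many
    points converge to those of phi_a, its coefficients converge to those of
    phi_a  [quotient_cvg], and the second equation becomes the theorem. *)


(** * Sums and products over the elements of a finite field *)

Section FiniteFieldIdentities.
Variables (F : finFieldType) (C : fieldType) (iota : {rmorphism F -> C}).
Local Notation q := #|F|.

Lemma finField_card_gt0 : (0 < q)%N.
Proof. exact: ltnW (finNzRing_gt1 F). Qed.

Lemma card_predK : q = q.-1.+1.
Proof. by rewrite prednK // finField_card_gt0. Qed.

Lemma card_natr0 : (q%:R : F) = 0.
Proof.
by apply/eqP; rewrite -FinRing.Theory.zmodXgE -cardsT expg_cardG ?inE.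
Qed.

Lemma frobD (B : comNzRingType) (k : {rmorphism F -> B}) (x y : B) :
  (x + y) ^+ q = x ^+ q + y ^+ q.
Proof.
have [p _ pF] := finPcharP F.
have pB : p \in [pchar B].
  move: pF; rewrite !inE => /andP[-> /eqP pF0] /=.
  by rewrite -(rmorph_nat k) pF0 rmorph0.
apply: exprDn_pchar; rewrite (eq_pnat _ (pcharf_eq pB)) -cardsT.
exact: abelem_pgroup (fin_ring_pchar_abelem pF).
Qed.

Lemma frobB (B : comNzRingType) (k : {rmorphism F -> B}) (x y : B) :
  (x - y) ^+ q = x ^+ q - y ^+ q.
Proof. by apply/eqP; rewrite eq_sym subr_eq -(frobD k) subrK. Qed.

Lemma frob_const c : iota c ^+ q = iota c.
Proof. by rewrite -rmorphXn expf_card. Qed.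

Lemma prod_sub_const z : \prod_c (z - iota c) = z ^+ q - z.
Proof.
have := congr1 (fun p => (map_poly iota p).[z]) (finField_genPoly F).
rewrite rmorphB /= map_polyXn map_polyX !hornerE => ->.
rewrite rmorph_prod horner_prod; apply: eq_bigr => c _.
by rewrite rmorphB /= map_polyX map_polyC !hornerE.
Qed.

Lemma log_deriv (s : seq C) z : (forall c, c \in s -> z != c) ->
  (\prod_(c <- s) ('X - c%:P))^`().[z] =
  (\prod_(c <- s) (z - c)) * \sum_(c <- s) (z - c)^-1.
Proof.
elim: s => [|c s IH] zs; first by rewrite !big_nil derivC horner0 mulr0.
have zc : z - c != 0 by rewrite subr_eq0 zs ?mem_head.
rewrite !big_cons derivM derivXsubC mul1r !hornerE IH; last first.
  by move=> d ds; apply: zs; rewrite inE ds orbT.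
rewrite horner_prod; under eq_bigr do rewrite hornerXsubC.
by rewrite mulrDr mulrAC divff // mul1r mulrA.
Qed.

(** The logarithmic derivative of X^q - X, whose derivative is -1. *)
Lemma sum_inv_const z : (forall c, z + iota c != 0) ->
  \sum_c (z + iota c)^-1 = (z - z ^+ q)^-1.
Proof.
move=> zc; pose s := [seq - iota c | c <- index_enum F].
have D : \prod_(c <- s) ('X - c%:P) = 'X^q - 'X.
  rewrite big_map; have := congr1 (map_poly iota) (finField_genPoly F).
  rewrite rmorphB /= map_polyXn map_polyX => ->; rewrite rmorph_prod.
  rewrite (reindex_inj oppr_inj) /=; apply: eq_bigr => c _.
  by rewrite rmorphB /= map_polyX map_polyC /= (rmorphN iota) opprK.
have := @log_deriv s z; rewrite D derivB derivX derivXn !hornerE.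
have -> : ('X^(q.-1) *+ q : {poly C}) = 0.
  rewrite -mulr_natr -(rmorph_nat polyC) -(rmorph_nat iota) card_natr0.
  by rewrite !rmorph0 mulr0.
rewrite horner0 sub0r !big_map => logD.
have {logD} : -1 = (\prod_c (z + iota c)) * \sum_c (z + iota c)^-1.
  rewrite logD; last by move=> _ /mapP [c _ ->]; rewrite -subr_eq0 opprK.
  by congr (_ * _); apply: eq_bigr => c _; rewrite opprK.
have -> : \prod_c (z + iota c) = z ^+ q - z.
  rewrite -prod_sub_const (reindex_inj oppr_inj) /=.
  by apply: eq_bigr => c _; rewrite rmorphN.
have nz : z ^+ q - z != 0.
  rewrite -prod_sub_const; apply/prodf_neq0 => c _.
  by rewrite -[c]opprK rmorphN opprK.
by move=> eq1; apply: (mulfI nz); rewrite -eq1 -[z - _]opprB invrN mulrN divff.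
Qed.

(** The F-line through h in C: z - h^(1-q) z^q is the exponential of that line,
    and the sum is its logarithmic derivative. *)
Lemma sum_inv_line z h : h != 0 -> (forall c, z + iota c * h != 0) ->
  \sum_c (z + iota c * h)^-1 = (z - h^-1 ^+ q.-1 * z ^+ q)^-1.
Proof.
move=> h0 zc.
have E c : z + iota c * h = h * (z / h + iota c) by field.
under eq_bigr do rewrite E invfM.
rewrite -mulr_sumr sum_inv_const; last first.
  by move=> c; have := zc c; rewrite E mulf_eq0 => /norP[].
rewrite -invfM; congr (_ ^-1).
have e : h * h^-1 ^+ q = h^-1 ^+ q.-1 by rewrite {1}card_predK exprS mulVKf.
by rewrite mulrBr mulrC divfK // exprMn mulrCA -e; ring.
Qed.

(** Follows from [sum_inv_line] because
    c / (z + c h) = h^-1 - (z / h) / (z + c h) and the constant h^-1 is summed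
    q times, where q = 0 in F. *)
Lemma sum_ratio_line z h : h != 0 -> (forall c, z + iota c * h != 0) ->
  \sum_c iota c / (z + iota c * h) =
  - (z / h) / (z - h^-1 ^+ q.-1 * z ^+ q).
Proof.
move=> h0 zc; rewrite -sum_inv_line //.
have E c : iota c / (z + iota c * h) = h^-1 - z / h * (z + iota c * h)^-1.
  by field; rewrite h0 zc.
under eq_bigr do rewrite E.
rewrite big_split /= sumr_const sumrN -mulr_sumr.
by rewrite -mulr_natr -(rmorph_nat iota) card_natr0 rmorph0 mulr0 add0r mulNr.
Qed.

Lemma prod_const_neq0 z : \prod_(c | c != 0) (1 - z / iota c) = 1 - z ^+ q.-1.
Proof.
have [->|z0] := eqVneq z 0.
  rewrite expr0n -subn1 subn_eq0 leqNgt finNzRing_gt1 subr0.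
  by rewrite big1 // => c _; rewrite mul0r subr0.
have E c : 1 - z / iota c = z * (z^-1 - iota c^-1).
  by rewrite mulrBr divff // fmorphV.
under eq_bigr do rewrite E.
rewrite (reindex_inj invr_inj) /=.
under eq_bigl do rewrite invr_eq0.
under eq_bigr do rewrite invrK.
have nz : z^-1 != 0 by rewrite invr_eq0.
have Ez : \prod_(c | c != 0) (z^-1 - iota c) = z^-1 ^+ q.-1 - 1.
  apply: (mulfI nz); rewrite mulrBr mulr1 -exprS -card_predK -prod_sub_const.
  by rewrite [RHS](bigD1 (0 : F)) //= rmorph0 subr0.
rewrite big_split /= prodr_const Ez cardC1 mulrBr mulr1 -exprMn divff //.
by rewrite expr1n.
Qed.
End FiniteFieldIdentities.

(** * Spans over a finite field inside a ring *)

Section Span.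
Variables (F : finFieldType) (A : comNzRingType) (kA : {rmorphism F -> A}).
Local Notation q := #|F|.

Fixpoint span (s : seq A) : seq A :=
  if s is x :: s' then
    [seq kA c * x + v | c <- index_enum F, v <- span s']
  else [:: 0].

(** Freeness over F, in the recursive form that inductions over [s] consume. *)
Fixpoint indep (s : seq A) : bool :=
  if s is x :: s' then (x \notin span s') && indep s' else true.

Definition lin_closed (P : A -> Prop) :=
  P 0 /\ forall c x y, P x -> P y -> P (kA c * x + y).

Lemma mem_span_cons x s b : reflect
  (exists c, exists2 v, v \in span s & b = kA c * x + v) (b \in span (x :: s)).
Proof.
apply: (iffP allpairsP) => [[[c v] [_ ? ->]]|[c [v vs ->]]]; first by exists c, v.
by exists (c, v); rewrite mem_index_enum.
Qed.

Lemma span_lin s : lin_closed (fun b => b \in span s).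
Proof.
split; elim: s => [|x s IH]; first by rewrite mem_head.
- by apply/mem_span_cons; exists 0, 0; rewrite // rmorph0 mul0r addr0.
- by move=> c b b'; rewrite !inE => /eqP-> /eqP->; rewrite mulr0 addr0.
- move=> c b b' /mem_span_cons [d [v vs ->]] /mem_span_cons [d' [v' vs' ->]].
  apply/mem_span_cons; exists (c * d + d'), (kA c * v + v'); first exact: IH.
  by rewrite rmorphD rmorphM; ring.
Qed.

Lemma mem_span0 s : 0 \in span s.
Proof. by case: (span_lin s). Qed.

Lemma span_lin2 s c x y :
  x \in span s -> y \in span s -> kA c * x + y \in span s.
Proof. by case: (span_lin s) => _; apply. Qed.

Lemma span_min P s x : lin_closed P -> P x ->
  (forall b, b \in span s -> P b) -> forall b, b \in span (x :: s) -> P b.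
Proof.
move=> [_ Plin] Px Ps b /mem_span_cons [c [v vs ->]].
exact/Plin/Ps.
Qed.

Lemma mem_span_shift x s c : x \notin span s ->
  (kA c * x \in span s) = (c == 0).
Proof.
move=> xs; apply/idP/eqP => [cx|->]; last by rewrite rmorph0 mul0r mem_span0.
apply/eqP; apply: contraNT xs => c0.
have := span_lin2 c^-1 cx (mem_span0 s).
by rewrite addr0 mulrA -rmorphM mulVf // rmorph1 mul1r.
Qed.

Lemma shift_neq0 x s c v :
  x \notin span s -> c != 0 -> v \in span s -> kA c * x + v != 0.
Proof.
move=> xs; rewrite -(mem_span_shift _ xs) => + vs; apply: contraNneq => e.
have := span_lin2 (-1) vs (mem_span0 s).
by rewrite rmorphN rmorph1 mulN1r addr0 -(addr0_eq e) opprK.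
Qed.

Lemma span_uniq s : indep s -> uniq (span s).
Proof.
elim: s => //= x s IH /andP[xs /IH us].
apply: allpairs_uniq => //; first exact: index_enum_uniq.
move=> [c v] [c' v'] /allpairsP[[d w] [_ /= ws [-> ->]]].
move=> /allpairsP[[d' w'] [_ /= ws' [-> ->]]] /= e.
have : kA (d - d') * x \in span s.
  have -> : kA (d - d') * x = kA (-1) * w + w'.
    by rewrite rmorphB rmorphN rmorph1; apply/eqP; rewrite -subr_eq0; apply/eqP;
       transitivity ((kA d * x + w) - (kA d' * x + w')); [ring|rewrite e subrr].
  exact: span_lin2.
rewrite mem_span_shift // subr_eq0 => /eqP dd; move: e; rewrite dd.
by move/addrI => ->.
Qed.

Lemma size_span s : size (span s) = (q ^ size s)%N.
Proof.
elim: s => //= x s IH; rewrite size_allpairs IH expnS; congr (_ * _)%N.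
by rewrite -(sum1_size (index_enum F)) sum1_card.
Qed.

Lemma size_indep_sub s s' : indep s -> {subset span s <= span s'} ->
  (size s <= size s')%N.
Proof.
move=> ind sub; have := uniq_leq_size (span_uniq ind) sub.
by rewrite !size_span leq_exp2l // finNzRing_gt1.
Qed.

(** The basis extension theorem, by induction on the codimension. *)
Lemma span_extend s s' : indep s -> {subset span s <= span s'} ->
  exists2 t, indep (t ++ s) & span (t ++ s) =i span s'.
Proof.
move e : (size s' - size s)%N => n; elim: n s e => [|n IH] s e ind sub.
  exists [::] => //= b; apply/idP/idP; first exact: sub.
  apply: contraTT => bs; apply/negP => bs'.
  have := @size_indep_sub (b :: s) s'; rewrite /= bs ind => /(_ isT) h.
  suff : (size s < size s')%N by rewrite -subn_gt0 e.
  apply: h; apply: span_min => //; split; first exact: mem_span0.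
  exact: span_lin2.
have [eqs|] := boolP (all (mem (span s)) (span s')).
  by exists [::] => //= b; apply/idP/idP; [apply: sub|apply/(allP eqs)].
case/allPn => b bs' bs.
have [|||t it st] := IH (b :: s).
- by rewrite /= subnS e.
- by rewrite /= bs.
- apply: span_min => //; split; first exact: mem_span0.
  exact: span_lin2.
by exists (t ++ [:: b]); rewrite -catA.
Qed.

Lemma span_scale a s : span [seq a * b | b <- s] = [seq a * b | b <- span s].
Proof.
elim: s => [|x s IH] /=; first by rewrite mulr0.
rewrite IH map_allpairs allpairs_mapr; apply: eq_allpairs => // c v.
by rewrite mulrDr mulrCA.
Qed.

Lemma indep_scale a s : injective (fun b => a * b) ->
  indep [seq a * b | b <- s] = indep s.
Proof. by move=> inj; elim: s => //= x s ->; rewrite span_scale mem_map. Qed.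

Lemma big_span_cons (V : Type) (idx : V) (op : Monoid.com_law idx) x s
    (f : A -> V) :
  \big[op/idx]_(b <- span (x :: s)) f b =
  \big[op/idx]_(c : F) \big[op/idx]_(v <- span s) f (kA c * x + v).
Proof. exact: big_allpairs_dep. Qed.
End Span.

(** * Exponentials of finite spaces *)

Section Exponential.
Variables (F : finFieldType) (C : fieldType) (iota : {rmorphism F -> C}).
Variables (A : comNzRingType) (kA : {rmorphism F -> A}) (l : A -> C).
Hypothesis l_lin : forall c b b', l (kA c * b + b') = iota c * l b + l b'.
Hypothesis l_inj : injective l.
Local Notation q := #|F|.
Local Notation span := (span kA).
Local Notation indep := (indep kA).

(** The exponential of the span of [s], built one line at a time; [expV_prod]
    identifies it with the product over the nonzero elements of the span, and
    the recursion exhibits the factorization into operators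
    1 - h^(1-q) tau. *)
Fixpoint expV (s : seq A) (y : C) : C :=
  if s is x :: s' then
    expV s' y - (expV s' (l x))^-1 ^+ q.-1 * expV s' y ^+ q
  else y.

Lemma lin_map0 : l 0 = 0.
Proof.
have /eqP := l_lin 1 0 0; rewrite !rmorph1 !mul1r addr0 -subr_eq0.
by rewrite opprD addNKr oppr_eq0 => /eqP.
Qed.

Lemma lin_map_neq0 b : b != 0 -> l b != 0.
Proof. by apply: contra_neq => lb; apply: l_inj; rewrite lb lin_map0. Qed.

Lemma expV_lin s c y z :
  expV s (iota c * y + z) = iota c * expV s y + expV s z.
Proof.
elim: s => //= x s ->; rewrite (frobD iota) exprMn frob_const.
ring.
Qed.

Lemma expV0 s : expV s 0 = 0.
Proof.
have /eqP := expV_lin s 1 0 0; rewrite rmorph1 !mul1r addr0 -subr_eq0.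
by rewrite opprD addNKr oppr_eq0 => /eqP.
Qed.

Lemma expV_shift s c x z : expV s (z - iota c * x) = expV s z - iota c * expV s x.
Proof. by rewrite addrC -mulNr -rmorphN expV_lin rmorphN mulNr addrC. Qed.

Lemma lin_map_shift c x v : l (kA c * x + v) = l v - (- (iota c * l x)).
Proof. by rewrite l_lin opprK addrC. Qed.

(** For b = 0 the factor is 1 because 0^-1 = 0, so that the product is over the
    nonzero elements of the span.  In the inductive step, the factors over the
    translate of V by c x multiply to E_V(y - c x) / E_V(- c x), which is
    1 - E_V(y) / (c h), and the product over c gives 1 - (E_V(y) / h)^(q-1). *)
Lemma expV_prod s y : indep s ->
  expV s y = y * \prod_(b <- span s) (1 - y / l b).
Proof.
elim: s y => [|x s IH] y.
  by rewrite /= big_seq1 lin_map0 invr0 mulr0 subr0 mulr1.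
case/andP=> xs ind; have {}IH z := IH z ind.
have us := span_uniq ind; have s0 := mem_span0 kA s.
(* Up to the constant - k, E_V(z) is the product of all l v - z, whose factor
   at v = 0 is - z. *)
pose k := \prod_(b <- span s | b != 0) l b.
have k0 : k != 0 by rewrite prodf_seq_neq0; apply/allP => b _; apply/implyP/lin_map_neq0.
have prodV z : \prod_(v <- span s) (l v - z) = - k * expV s z.
  rewrite IH !(bigD1_seq 0) //= lin_map0 invr0 mulr0 subr0 sub0r mul1r.
  suff -> : \prod_(b <- span s | b != 0) (l b - z) =
      k * \prod_(b <- span s | b != 0) (1 - z / l b) by ring.
  rewrite -big_split /=; apply: eq_bigr => b b0.
  by rewrite mulrBr mulr1 mulrCA divff ?mulr1 // lin_map_neq0.
have hE c : expV s (- (iota c * l x)) = - (iota c * expV s (l x)).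
  by rewrite -[- (_ * _)]add0r expV_shift expV0 add0r.
have inner c : c != 0 ->
    \prod_(v <- span s) (1 - y / l (kA c * x + v)) =
    1 - expV s y / expV s (l x) / iota c.
  move=> c0; have d0 : - (iota c * expV s (l x)) != 0.
    have : \prod_(v <- span s) (l v - - (iota c * l x)) != 0.
      rewrite prodf_seq_neq0; apply/allP => v vs /=.
      by rewrite -lin_map_shift lin_map_neq0 // (shift_neq0 xs).
    by rewrite prodV hE mulf_eq0 negb_or => /andP[].
  have := d0; rewrite oppr_eq0 mulf_eq0 negb_or => /andP[ic h0].
  have -> : \prod_(v <- span s) (1 - y / l (kA c * x + v)) =
      \prod_(v <- span s) (l v - (y - iota c * l x)) /
      \prod_(v <- span s) (l v - (- (iota c * l x))).
    rewrite -prodf_div; apply: eq_big_seq => v vs; rewrite lin_map_shift.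
    have : l v - - (iota c * l x) != 0 by rewrite -lin_map_shift lin_map_neq0 // (shift_neq0 xs).
    by move=> w0; field.
  rewrite !prodV hE expV_shift.
  by field; rewrite ic h0 d0 oppr_eq0.
rewrite [LHS]/= big_span_cons (bigD1 0) //= rmorph0 mul0r.
under [in X in _ * (X * _)]eq_bigr do rewrite add0r.
rewrite mulrA -IH.
under eq_bigr => c c0 do rewrite inner //.
rewrite (prod_const_neq0 iota) mulrBr mulr1; congr (_ - _).
by rewrite [in LHS](card_predK F) /= exprS exprMn mulrCA [_ ^+ _ * (_ ^+ _)]mulrC.
Qed.

Lemma expV_eq0 s y : indep s -> expV s y = 0 -> exists2 b, b \in span s & y = l b.
Proof.
move=> ind /eqP; rewrite expV_prod // mulf_eq0 => /orP[/eqP->|].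
  by exists 0; rewrite ?mem_span0 ?lin_map0.
rewrite prodf_seq_eq0 => /hasP [b bs /=]; rewrite subr_eq0 eq_sym => /eqP e.
exists b => //; have lb0 : l b != 0.
  apply/eqP => lb0; move/eqP: e.
  by rewrite lb0 invr0 mulr0 eq_sym oner_eq0.
by rewrite -[LHS](divfK lb0) e mul1r.
Qed.

Lemma expV_neq0 s x : indep s -> x \notin span s -> expV s (l x) != 0.
Proof.
move=> ind; apply: contraNneq => /(expV_eq0 ind) [b bs /l_inj ->] //.
Qed.

Definition off (s : seq A) (y : C) := forall b, b \in span s -> y + l b != 0.

Lemma off_shift x s y c : off (x :: s) y -> off s (y + iota c * l x).
Proof.
move=> oy b bs; rewrite -addrA -l_lin oy //.
by apply/mem_span_cons; exists c, b.
Qed.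

Lemma off_line x s c : x \notin span s -> c != 0 -> off s (iota c * l x).
Proof. by move=> xs c0 b bs; rewrite -l_lin lin_map_neq0 // (shift_neq0 xs). Qed.

Lemma expV_off s y : indep s -> off s y -> expV s y != 0.
Proof.
move=> ind oy; apply/eqP => /(expV_eq0 ind) [b bs e].
have := oy (kA (-1) * b + 0) (span_lin2 _ bs (mem_span0 _ _)).
by rewrite l_lin rmorphN rmorph1 mulN1r lin_map0 addr0 e subrr eqxx.
Qed.

Lemma expV_addZ s y c x :
  expV s (y + iota c * x) = expV s y + iota c * expV s x.
Proof. by rewrite addrC expV_lin addrC. Qed.

(** E_V has derivative 1.  In the inductive step the translate of V by c x
    contributes 1 / (E_V(y) + c h), and [sum_inv_line] sums this over c. *)
Lemma expV_logderiv s y : indep s -> off s y ->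
  \sum_(b <- span s) (y + l b)^-1 = (expV s y)^-1.
Proof.
elim: s y => [|x s IH] y; first by rewrite /= big_seq1 lin_map0 addr0.
case/andP => xs ind oy; rewrite big_span_cons.
under eq_bigr => c _.
  under eq_bigr do rewrite l_lin addrA.
  rewrite IH //; last exact: off_shift.
  rewrite expV_addZ.
over.
rewrite (sum_inv_line (expV_neq0 ind xs)) // => c.
by rewrite -expV_addZ expV_off //; apply: off_shift.
Qed.
End Exponential.

(** * The adjoint identity for finite spaces *)

Section Tensor.
Variables (F : finFieldType) (C : fieldType) (iota : {rmorphism F -> C}).
Variables (A : comNzRingType) (kA : {rmorphism F -> A}) (l : A -> C).
Hypothesis l_lin : forall c b b', l (kA c * b + b') = iota c * l b + l b'.
Hypothesis l_inj : injective l.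
Variables (T : comNzRingType) (L : {rmorphism C -> T}) (Rr : {rmorphism A -> T}).
Hypothesis balanced : forall c, L (iota c) = Rr (kA c).
Variable tV : T -> T.
Hypothesis tVD : forall x y, tV (x + y) = tV x + tV y.
Hypothesis tV1 : tV 1 = 1.
Hypothesis tVL : forall c x, tV (L (c ^+ #|F|) * x) = L c * tV x.
Hypothesis tVR : forall a x, tV (Rr a * x) = Rr a * tV x.
Local Notation q := #|F|.
Local Notation span := (span kA).
Local Notation indep := (indep kA).
Local Notation expV := (expV F l).
Local Notation off := (off kA l).

(** The term of 0 vanishes, so that this is the sum over the nonzero elements. *)
Definition zetaV (s : seq A) : T := \sum_(b <- span s) L (l b)^-1 * Rr b.

(** The F-linear interpolation polynomial with coefficients in T which maps
    l v to 1 (x) v on the span.  Adding x to the basis corrects it by the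
    multiple of E_V that gives the right value at l x. *)
Fixpoint interp (s : seq A) (y : C) : T :=
  if s is x :: s' then
    interp s' y +
    L (expV s' y / expV s' (l x)) * (Rr x - interp s' (l x))
  else 0.

Lemma tV0 : tV 0 = 0.
Proof. by have /eqP := tVD 0 0; rewrite addr0 -subr_eq0 opprD addNKr oppr_eq0 => /eqP. Qed.

Lemma tVN x : tV (- x) = - tV x.
Proof. by apply/eqP; rewrite -addr_eq0 -tVD addNr tV0. Qed.

Lemma tVB x y : tV (x - y) = tV x - tV y.
Proof. by rewrite tVD tVN. Qed.

Lemma interp_lin s c y z :
  interp s (iota c * y + z) = L (iota c) * interp s y + interp s z.
Proof.
elim: s => [|x s IH] /=; first by rewrite mulr0 addr0.
rewrite IH expV_lin !rmorphM rmorphD !rmorphM; ring.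
Qed.

Lemma interp0 s : interp s 0 = 0.
Proof.
have /eqP := interp_lin s 1 0 0; rewrite !rmorph1 !mul1r addr0 -subr_eq0.
by rewrite opprD addNKr oppr_eq0 => /eqP.
Qed.

Lemma interp_addZ s y c x :
  interp s (y + iota c * x) = interp s y + L (iota c) * interp s x.
Proof. by rewrite addrC interp_lin addrC. Qed.

(** Partial fractions: E_V has derivative 1 at each of its zeros, so the residue
    of the interpolation polynomial over E_V at l v is the interpolated value. *)
Lemma interp_partial_fraction s y : indep s -> off s y ->
  \sum_(b <- span s) L (y + l b)^-1 * Rr b = - (L (expV s y)^-1 * interp s y).
Proof.
elim: s y => [|x s IH] y.
  by rewrite /= big_seq1 rmorph0 mulr0 mulr0 oppr0.
case/andP => xs ind oy; rewrite big_span_cons.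
have offc c := off_shift l_lin c oy.
have h0 := expV_neq0 l_lin l_inj ind xs.
have hc c : expV s y + iota c * expV s (l x) != 0.
  by rewrite -(expV_addZ iota) (expV_off l_lin).
under eq_bigr => c _.
  under eq_bigr do rewrite l_lin addrA rmorphD rmorphM -balanced mulrDr.
  rewrite big_split /= -mulr_suml -rmorph_sum (expV_logderiv l_lin l_inj) //.
  rewrite IH // interp_addZ expV_addZ.
  have -> : L (expV s y + iota c * expV s (l x))^-1 * (L (iota c) * Rr x) -
      L (expV s y + iota c * expV s (l x))^-1 *
        (interp s y + L (iota c) * interp s (l x)) =
      L (iota c / (expV s y + iota c * expV s (l x))) * (Rr x - interp s (l x))
      - L (expV s y + iota c * expV s (l x))^-1 * interp s y.
    by rewrite [L (_ / _)]rmorphM; ring.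
over.
rewrite sumrB -!mulr_suml -!rmorph_sum sum_inv_line // sum_ratio_line //.
by rewrite [interp (_ :: _) _]/= mulNr rmorphN !rmorphM; ring.
Qed.

(** Each of the q - 1 nonzero multiples of x contributes the same amount to the
    new terms, and q - 1 = -1 in T. *)
Lemma zetaV_cons x s : indep (x :: s) ->
  zetaV (x :: s) =
  zetaV s - L (expV s (l x))^-1 * (Rr x - interp s (l x)).
Proof.
case/andP => xs ind; rewrite /zetaV big_span_cons (bigD1 0) //=.
under eq_bigr do rewrite rmorph0 mul0r add0r.
congr (_ + _).
have h0 := expV_neq0 l_lin l_inj ind xs.
under eq_bigr => c c0.
  have oc := off_line l_lin l_inj xs c0.
  under eq_bigr do rewrite l_lin rmorphD rmorphM -balanced mulrDr.
  rewrite big_split /= -mulr_suml -rmorph_sum (expV_logderiv l_lin l_inj) //.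
  rewrite interp_partial_fraction // -[iota c * l x]addr0 interp_lin expV_lin.
  rewrite interp0 (expV0 iota) !addr0.
  have -> : L (iota c * expV s (l x))^-1 * (L (iota c) * Rr x) -
      L (iota c * expV s (l x))^-1 * (L (iota c) * interp s (l x)) =
      L (expV s (l x))^-1 * (Rr x - interp s (l x)).
    have ic : iota c != 0 by rewrite fmorph_eq0.
    have e : L (iota c * expV s (l x))^-1 * L (iota c) = L (expV s (l x))^-1.
      by rewrite -rmorphM; congr (L _); field; rewrite ic h0.
    by rewrite !mulrA e mulrBr.
over.
rewrite sumr_const cardC1 -mulr_natr.
have -> : (q.-1)%:R = -1 :> T.
  apply/eqP; rewrite -addr_eq0 -[1]/(1%:R) -natrD addn1 -card_predK.
  by rewrite -(rmorph_nat Rr) -(rmorph_nat kA) card_natr0 !rmorph0.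
by rewrite mulrN1.
Qed.

(** With [zetaV_cons], it expresses the difference of Z_V and Z_U through Z_U
    alone.  It is the equation of [tV_interp] at y = l x, multiplied by h^-q. *)
Lemma zetaV_increment x s : indep (x :: s) ->
  (forall y, tV (interp s y + L (expV s y) * zetaV s) = interp s y) ->
  L (expV s (l x))^-1 * (Rr x - interp s (l x)) =
  - tV (L ((expV s (l x))^-1 ^+ q.-1) * zetaV (x :: s)).
Proof.
case/andP => xs ind tVi; rewrite zetaV_cons /= ?xs //.
have h0 := expV_neq0 l_lin l_inj ind xs; set h := expV s (l x) in h0 *.
(* Factor out h^-q, which tau^-1 turns into h^-1. *)
have -> : L (h^-1 ^+ q.-1) * (zetaV s - L h^-1 * (Rr x - interp s (l x))) =
    L (h^-1 ^+ q) * (interp s (l x) + L h * zetaV s - Rr x * 1).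
  rewrite [in RHS](card_predK F) exprS rmorphM.
  have e : L h^-1 * L h = 1 by rewrite -rmorphM mulVf // rmorph1.
  rewrite mulr1 -[zetaV s in LHS]mul1r -e; ring.
by rewrite tVL tVB tVi tVR tV1 mulr1 -mulrN opprB.
Qed.

(** Coefficientwise, this says that (tau - 1) g_V = Z_V E_V, where tau acts on
    the coefficients in C: applying tau^-1 to the value of (g_V + Z_V E_V) at y
    gives back g_V(y). *)
Lemma tV_interp s y : indep s ->
  tV (interp s y + L (expV s y) * zetaV s) = interp s y.
Proof.
elim: s y => [|x s IH] y ind.
  by rewrite /= /zetaV big_seq1 rmorph0 !mulr0 addr0 tV0.
have ind' : indep s by case/andP: ind.
have {}IH y' := IH y' ind'.
have Y := zetaV_increment ind IH.
rewrite (zetaV_cons ind) in Y *; rewrite [interp _ _]/= [expV _ _]/=.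
set h := expV s (l x) in Y *; set Y0 := Rr x - _ in Y *.
have -> : interp s y + L (expV s y / h) * Y0 +
   L (expV s y - h^-1 ^+ q.-1 * expV s y ^+ q) * (zetaV s - L h^-1 * Y0) =
   interp s y + L (expV s y) * zetaV s -
   L (expV s y ^+ q) * (L (h^-1 ^+ q.-1) * (zetaV s - L h^-1 * Y0)).
  by rewrite rmorphB !rmorphM; ring.
by rewrite tVB IH tVL -mulrN -Y mulrA -rmorphM.
Qed.

(** The case of codimension 1 of the adjoint identity. *)
Lemma zetaV_step x s : indep (x :: s) ->
  zetaV (x :: s) - tV (L ((expV s (l x))^-1 ^+ q.-1) * zetaV (x :: s)) = zetaV s.
Proof.
move=> ind; have ind' : indep s by case/andP: ind.
rewrite -zetaV_increment //; last by move=> y; exact: tV_interp.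
by rewrite zetaV_cons // subrK.
Qed.

(** The coefficients of the operator P in C[tau] for which
    E_(t ++ s) = P E_s, read off the recursion for [expV]. *)
Fixpoint quot_coef (t s : seq A) (i : nat) : C :=
  if t is x :: t' then
    quot_coef t' s i - (expV (t' ++ s) (l x))^-1 ^+ q.-1 *
      (if i is k.+1 then quot_coef t' s k ^+ q else 0)
  else (i == 0%N)%:R.

Lemma quot_coef_gt t s i : (size t < i)%N -> quot_coef t s i = 0.
Proof.
elim: t i => [|x t IH] [|i] //= ti.
rewrite IH ?IH //; last by rewrite ltnW.
by rewrite expr0n eqn0Ngt finField_card_gt0 mulr0 subr0.
Qed.

Lemma frob_sum (B : comNzRingType) (k : {rmorphism F -> B}) n (f : 'I_n -> B) :
  (\sum_i f i) ^+ q = \sum_i f i ^+ q.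
Proof.
apply: (big_morph (fun x => x ^+ q) (frobD k)).
by rewrite expr0n eqn0Ngt finField_card_gt0.
Qed.

Lemma expV_quot t s n y : (size t <= n)%N ->
  expV (t ++ s) y = \sum_(i < n.+1) quot_coef t s i * expV s y ^+ (q ^ i).
Proof.
elim: t n => [|x t IH] n tn /=.
  rewrite big_ord_recl /= mul1r big1 ?addr0 // => i _.
  by rewrite mul0r.
case: n tn => // n tn.
rewrite [in RHS]big_ord_recl /= mulr0 subr0.
under [in RHS]eq_bigr do rewrite /bump /= add1n mulrBl.
rewrite sumrB addrA; congr (_ - _).
  rewrite (IH n.+1) ?big_ord_recl //; last exact: ltnW.
rewrite (IH n) // (frob_sum iota) mulr_sumr.
apply: eq_bigr => i _.
by rewrite exprMn -exprM -expnSr mulrA.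
Qed.

Lemma iter_tVB n x y : iter n tV (x - y) = iter n tV x - iter n tV y.
Proof. by elim: n => //= n ->; rewrite tVB. Qed.

Lemma iter_tV0 n : iter n tV 0 = 0.
Proof. by elim: n => //= n ->; rewrite tV0. Qed.

(** P^* maps Z_(t ++ s) to Z_s: the adjoint reverses products, so the operator
    attached to the last line added acts first. *)
Lemma zetaV_quot t s n : (size t <= n)%N -> indep (t ++ s) ->
  \sum_(i < n.+1) iter i tV (L (quot_coef t s i) * zetaV (t ++ s)) = zetaV s.
Proof.
elim: t n => [|x t IH] n tn ind.
  rewrite big_ord_recl /= rmorph1 mul1r big1 ?addr0 // => i _.
  by rewrite rmorph0 mul0r iter_tV0 tV0.
case: n tn => // n tn; set W := zetaV _.
have ind' : indep (t ++ s) by case/andP: ind.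
have recl (f : nat -> T) m :
  \sum_(i < m.+1) f i = f 0%N + \sum_(i < m) f i.+1 by rewrite big_ord_recl.
rewrite -(IH n) // -(zetaV_step ind) -/W -/cat.
rewrite (recl (fun i => iter i tV (L (quot_coef (x :: t) s i) * W))).
set h := (expV _ _)^-1 ^+ q.-1.
under eq_bigr => i _.
  rewrite [quot_coef _ _ _]/= -/h rmorphB mulrBl iter_tVB [X in _ - X]iterSr.
  rewrite [h * _]mulrC rmorphM -mulrA tVL.
over.
under [RHS]eq_bigr do rewrite mulrBr iter_tVB.
rewrite !sumrB addrA; congr (_ - _).
have := recl (fun i => iter i tV (L (quot_coef t s i) * W)) n.+1.
rewrite [quot_coef (x :: t) s 0]/= mulr0 subr0 => <-.
by rewrite big_ord_recr /= quot_coef_gt // rmorph0 mul0r -iterS iter_tV0 addr0.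
Qed.
End Tensor.

(** * Convergence for ultrametric norms *)

Section Convergence.
Variables (R : realType) (V : zmodType) (N : V -> R).
Hypothesis ultraN : ultrametric N.

Lemma ultra0 : N 0 = 0.
Proof. by apply/(ultraN.1 0). Qed.

Lemma ultra_ge0 x : 0 <= N x.
Proof. by have := ultraN.2 x x; rewrite subrr ultra0 maxxx. Qed.

Lemma ultra_eq0 x : (N x == 0) = (x == 0).
Proof. by apply/eqP/eqP => /(ultraN.1 x). Qed.

Lemma ultra_opp x : N (- x) = N x.
Proof.
have le y : N (- y) <= N y.
  have := ultraN.2 0 y; rewrite sub0r ultra0 => /le_trans; apply.
  by rewrite ge_max ultra_ge0 lexx.
by apply/le_anti; rewrite le /= -{1}[x]opprK le.
Qed.

Lemma ultraD x y : N (x + y) <= Num.max (N x) (N y).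
Proof. by have := ultraN.2 x (- y); rewrite opprK ultra_opp. Qed.

Lemma ultra_sym x y : N (x - y) = N (y - x).
Proof. by rewrite -ultra_opp opprB. Qed.

Lemma ultraD_lt x y e : N x < e -> N y < e -> N (x + y) < e.
Proof. by move=> xe ye; apply: le_lt_trans (ultraD x y) _; rewrite gt_max xe. Qed.

Lemma ultra_trans z x y e : N (x - z) < e -> N (z - y) < e -> N (x - y) < e.
Proof. by move=> xz zy; rewrite -(subrK z x) -addrA ultraD_lt. Qed.

Lemma ultra_sum_le (I : eqType) (r : seq I) (f : I -> V) e : 0 <= e ->
  (forall i, i \in r -> N (f i) <= e) -> N (\sum_(i <- r) f i) <= e.
Proof.
move=> e0 fe; rewrite big_seq; elim/big_ind: _ => //; first by rewrite ultra0.
by move=> x y xe ye; apply: le_trans (ultraD x y) _; rewrite ge_max xe.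
Qed.

Lemma ultra_dominant x y : N (x - y) < N y -> N x = N y.
Proof.
move=> xy; apply/le_anti/andP; split.
  rewrite -[X in N X](subrK y); apply: le_trans (ultraD _ _) _.
  by rewrite ge_max lexx ltW.
have := ultraN.2 x (x - y); rewrite subKr le_max => /orP[//|yx].
by have := le_lt_trans yx xy; rewrite ltxx.
Qed.

Definition cvgto (u : nat -> V) (l : V) : Prop :=
  forall e, 0 < e -> exists M, forall n, (M <= n)%N -> N (u n - l) < e.

Lemma cvgto_cst l : cvgto (fun _ => l) l.
Proof. by move=> e e0; exists 0%N => n _; rewrite subrr ultra0. Qed.

Lemma cvgtoD u v l m : cvgto u l -> cvgto v m ->
  cvgto (fun n => u n + v n) (l + m).
Proof.
move=> ul vm e e0; have [M uM] := ul e e0; have [M' val_mul] := vm e e0.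
exists (maxn M M') => n; rewrite geq_max => /andP[Mn M'n].
by rewrite opprD addrACA; apply: ultraD_lt; [apply: uM|apply: val_mul].
Qed.

Lemma cvgtoN u l : cvgto u l -> cvgto (fun n => - u n) (- l).
Proof.
move=> ul e e0; have [M uM] := ul e e0; exists M => n Mn.
by rewrite -opprD ultra_opp uM.
Qed.

Lemma cvgtoB u v l m : cvgto u l -> cvgto v m ->
  cvgto (fun n => u n - v n) (l - m).
Proof. by move=> ul vm; apply: cvgtoD => //; apply: cvgtoN. Qed.

Lemma cvgto_sum (I : Type) (r : seq I) (u : I -> nat -> V) l :
  (forall i, cvgto (u i) (l i)) ->
  cvgto (fun n => \sum_(i <- r) u i n) (\sum_(i <- r) l i).
Proof.
move=> ul; elim: r => [|i r IH].
  rewrite big_nil; under eq_fun do rewrite big_nil; exact: cvgto_cst.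
rewrite big_cons; under eq_fun do rewrite big_cons; exact: cvgtoD.
Qed.

Lemma cvgto_eq u v l : (forall n, u n = v n) -> cvgto v l -> cvgto u l.
Proof. by move=> /funext ->. Qed.

Lemma cvgto_eql u l m : l = m -> cvgto u l -> cvgto u m.
Proof. by move=> <-. Qed.

Lemma cvgto_unique u l m : cvgto u l -> cvgto u m -> l = m.
Proof.
move=> ul um; apply/eqP; rewrite -subr_eq0 -ultra_eq0 eq_le ultra_ge0 andbT.
apply/ler_addgt0Pr => e e0; rewrite add0r ltW //.
have [M uM] := ul e e0; have [M' uM'] := um e e0.
have n1 := uM _ (leq_maxl M M'); have n2 := uM' _ (leq_maxr M M').
by apply: (ultra_trans (z := u (maxn M M'))) => //; rewrite ultra_sym.
Qed.

Lemma cvgto_of_inv u l : (forall n, N (u n - l) < n.+1%:R^-1) -> cvgto u l.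
Proof.
move=> ul e e0; exists (Num.Def.truncn e^-1) => n Mn; apply: lt_trans (ul n) _.
rewrite -[e]invrK ltf_pV2 ?posrE ?ltr0Sn ?invr_gt0 //.
by rewrite -truncn_le_nat.
Qed.

Lemma cvgto_shift u l k : cvgto u l -> cvgto (fun n => u (n + k)%N) l.
Proof.
move=> ul e e0; have [M uM] := ul e e0; exists M => n Mn.
by rewrite uM // (leq_trans Mn) // leq_addr.
Qed.

Lemma cvgto_bounded u l : cvgto u l ->
  exists B, 0 < B /\ exists M, forall n, (M <= n)%N -> N (u n) <= B.
Proof.
move=> ul; exists (Num.max 1 (N l)); split; first by rewrite lt_max ltr01.
have [M uM] := ul 1 ltr01; exists M => n Mn.
rewrite -(subrK l (u n)); apply: le_trans (ultraD _ _) _.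
by rewrite ge_max !le_max lexx orbT andbT ltW ?uM.
Qed.

(** A net over finite sets whose tails beyond the sets J n oscillate less and
    less converges, and its limit is that of the sequence along J. *)
Lemma finset_lim_seq (I : choiceType) (S : set I) (f : {fset I} -> V)
    (J : nat -> {fset I}) :
  complete_for N ->
  (forall n, [set` J n] `<=` S) ->
  (forall n m, (n <= m)%N -> (J n `<=` J m)%fset) ->
  (forall e, 0 < e -> exists M, forall J' : {fset I}, [set` J'] `<=` S ->
     (J M `<=` J')%fset -> N (f J' - f (J M)) < e) ->
  cvgto (fun n => f (J n)) (finset_lim N S f).
Proof.
move=> complN JS Jmono fJ.
have {}fJ e : 0 < e -> exists M, forall n, (M <= n)%N ->
    forall J' : {fset I}, [set` J'] `<=` S -> (J n `<=` J')%fset ->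
    N (f J' - f (J n)) < e.
  move=> e0; have [M fM] := fJ e e0; exists M => n Mn J' J'S nJ'.
  have MJ' := fsubset_trans (Jmono _ _ Mn) nJ'.
  apply: (ultra_trans (z := f (J M))); first exact: fM.
  by rewrite ultra_sym fM //; apply: Jmono.
have [|l Jl] := complN (fun n => f (J n)).
  move=> e e0; have [M fM] := fJ e e0; exists M => m n Mm Mn.
  apply: (ultra_trans (z := f (J M))); first by apply: fM => //; apply: Jmono.
  by rewrite ultra_sym fM //; apply: Jmono.
have : exists l', [set l' | forall e, 0 < e ->
    exists2 J0 : {fset I}, [set` J0] `<=` S &
      forall J : {fset I}, [set` J] `<=` S -> (J0 `<=` J)%fset ->
        N (f J - l') < e] l'.
  exists l => e e0; have [M fM] := fJ e e0; have [M' lM] := Jl e e0.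
  exists (J (maxn M M')); first exact: JS.
  move=> J' J'S sub; apply: (ultra_trans (z := f (J (maxn M M')))).
    by apply: fM => //; apply: leq_maxl.
  by apply: lM; apply: leq_maxr.
move=> [l' l'P]; have := xgetI 0 l'P; rewrite -/(finset_lim N S f).
move: (finset_lim _ _ _) => {l' l'P} l' l'P e e0.
have [J0 J0S J0P] := l'P e e0; have [M fM] := fJ e e0.
exists M => n Mn; apply: (ultra_trans (z := f (J n `|` J0)%fset)).
  rewrite ultra_sym fM ?fsubsetUl // => i /=; rewrite inE => /orP[].
    exact: JS.
  exact: J0S.
apply: J0P; last exact: fsubsetUr.
move=> i /=; rewrite inE => /orP[]; first exact: JS.
exact: J0S.
Qed.
End Convergence.

Section Multiplication.
Variables (R : realType) (B : pzRingType) (N : B -> R).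
Hypothesis ultraN : ultrametric N.
Hypothesis subM : forall x y, N (x * y) <= N x * N y.
Local Notation cvgto := (cvgto N).

Lemma cvgto0M u v m : cvgto u 0 -> cvgto v m -> cvgto (fun n => u n * v n) 0.
Proof.
move=> u0 vm e e0; have [K [K0 [M val_mul]]] := cvgto_bounded ultraN vm.
have [M' uM] := u0 (e / K) (divr_gt0 e0 K0).
exists (maxn M M') => n; rewrite geq_max => /andP[Mn M'n].
rewrite subr0; apply: le_lt_trans (subM _ _) _.
have := uM n M'n; rewrite subr0 ltr_pdivlMr // => /(le_lt_trans _); apply.
by apply: ler_wpM2l; [apply: ultra_ge0|apply: val_mul].
Qed.

Lemma cvgtoM0 u v l : cvgto u l -> cvgto v 0 -> cvgto (fun n => u n * v n) 0.
Proof.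
move=> ul v0 e e0; have [K [K0 [M uM]]] := cvgto_bounded ultraN ul.
have [M' val_mul] := v0 (e / K) (divr_gt0 e0 K0).
exists (maxn M M') => n; rewrite geq_max => /andP[Mn M'n].
rewrite subr0; apply: le_lt_trans (subM _ _) _.
have := val_mul n M'n; rewrite subr0 ltr_pdivlMr // mulrC => /(le_lt_trans _); apply.
by apply: ler_wpM2r; [apply: ultra_ge0|apply: uM].
Qed.

Lemma cvgtoM u v l m : cvgto u l -> cvgto v m ->
  cvgto (fun n => u n * v n) (l * m).
Proof.
move=> ul vm.
have -> : l * m = 0 + 0 + l * m by rewrite !add0r.
apply: (@cvgto_eq _ _ _ _ (fun n => (u n - l) * v n + l * (v n - m) + l * m)).
  by move=> n; rewrite mulrBl mulrBr addrA subrK subrK.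
apply: cvgtoD => //; last exact: cvgto_cst.
apply: cvgtoD => //.
  apply: cvgto0M vm; rewrite -(subrr l).
  by apply: cvgtoB => //; apply: cvgto_cst.
apply: cvgtoM0; first exact: cvgto_cst.
by rewrite -(subrr m); apply: cvgtoB => //; apply: cvgto_cst.
Qed.

Lemma cvgtoX u l k : cvgto u l -> cvgto (fun n => u n ^+ k) (l ^+ k).
Proof.
move=> ul; elim: k => [|k IH]; first exact: cvgto_cst.
by rewrite exprS; under eq_fun do rewrite exprS; apply: cvgtoM.
Qed.
End Multiplication.

(** * Infinite sums, infinite products and coefficientwise convergence *)

Lemma big_fset_split (V : Type) (idx : V) (op : Monoid.com_law idx)
    (K : choiceType) (J J' : {fset K}) (f : K -> V) : (J `<=` J')%fset ->
  \big[op/idx]_(i <- enum_fset J') f i =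
  op (\big[op/idx]_(i <- enum_fset J) f i)
     (\big[op/idx]_(i <- enum_fset J' | i \notin J) f i).
Proof.
move=> sub; rewrite (bigID (mem J)) /=; congr (op _ _).
rewrite -big_filter; apply/perm_big/uniq_perm => [||i].
- by rewrite filter_uniq // fset_uniq.
- exact: fset_uniq.
by rewrite mem_filter andb_idr // => /(fsubsetP sub).
Qed.

Lemma big_fset_seq (V : Type) (idx : V) (op : Monoid.com_law idx)
    (K : choiceType) (r : seq K) (f : K -> V) : uniq r ->
  \big[op/idx]_(i <- enum_fset [fset x in r]%fset) f i =
  \big[op/idx]_(i <- r) f i.
Proof.
move=> ur; apply/perm_big/uniq_perm => // i; by rewrite inE.
Qed.

Section InfiniteSum.
Variables (R : realType) (V : zmodType) (N : V -> R).
Hypothesis ultraN : ultrametric N.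
Hypothesis complN : complete_for N.

Lemma infinite_sum_seq (K : choiceType) (S : set K) (g : K -> V)
    (J : nat -> {fset K}) :
  (forall n, [set` J n] `<=` S) ->
  (forall n m, (n <= m)%N -> (J n `<=` J m)%fset) ->
  (forall e, 0 < e -> exists M, forall i, S i -> i \notin J M -> N (g i) < e) ->
  cvgto N (fun n => \sum_(i <- enum_fset (J n)) g i) (infinite_sum N S g).
Proof.
move=> JS Jmono gJ; apply: (finset_lim_seq ultraN) => // e e0.
have [M gM] := gJ _ (divr_gt0 e0 (ltr0Sn R 1)); exists M => J' J'S sub.
rewrite (big_fset_split _ _ sub) /= addrAC subrr add0r -big_filter.
have : e / 2 < e by rewrite ltr_pdivrMr // ltr_pMr // ltr1n.
apply: le_lt_trans; apply: ultra_sum_le => //; first by rewrite divr_ge0 // ltW.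
by move=> i; rewrite mem_filter => /andP[iM iJ']; rewrite ltW // gM //; apply: J'S.
Qed.
End InfiniteSum.

Section AbsoluteValue.
Variables (R : realType) (C : fieldType) (N : C -> R).
Hypothesis absN : absolute_value N.
Let ultraN : ultrametric N := absN.1.
Let normM x y : N (x * y) = N x * N y := absN.2 x y.
Local Notation cvgto := (cvgto N).

Lemma abs_subM x y : N (x * y) <= N x * N y.
Proof. by rewrite normM. Qed.

Lemma abs1 : N 1 = 1.
Proof.
have n0 : N 1 != 0 by rewrite (ultra_eq0 ultraN) oner_eq0.
by apply: (mulfI n0); rewrite -normM !mulr1.
Qed.

Lemma abs_gt0 x : x != 0 -> 0 < N x.
Proof. by move=> x0; rewrite lt0r (ultra_eq0 ultraN) x0 (ultra_ge0 ultraN). Qed.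

Lemma absV x : N x^-1 = (N x)^-1.
Proof.
have [->|x0] := eqVneq x 0; first by rewrite invr0 (ultra0 ultraN) invr0.
have n0 : N x != 0 by rewrite (ultra_eq0 ultraN).
by apply: (mulfI n0); rewrite -normM !divff // abs1.
Qed.

Lemma absX x n : N (x ^+ n) = N x ^+ n.
Proof. by elim: n => [|n IH]; rewrite ?abs1 // !exprS normM IH. Qed.

Lemma abs_prod_near1 (I : eqType) (r : seq I) (g : I -> C) d : 0 <= d <= 1 ->
  (forall i, i \in r -> N (g i - 1) <= d) -> N (\prod_(i <- r) g i - 1) <= d.
Proof.
move=> /andP[d0 d1] gd; rewrite big_seq.
apply: (@big_ind _ (fun p => N (p - 1) <= d)) => //.
  by rewrite subrr (ultra0 ultraN).
move=> x y xd yd; have -> : x * y - 1 = (x - 1) * y + (y - 1) by ring.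
apply: le_trans (ultraD ultraN _ _) _; rewrite ge_max yd andbT normM.
rewrite -[d]mulr1; apply: ler_pM => //; rewrite ?(ultra_ge0 ultraN) //.
rewrite -[y](subrK 1); apply: le_trans (ultraD ultraN _ _) _.
by rewrite ge_max abs1 lexx andbT (le_trans yd).
Qed.

(** The factors outside a large J n are near 1, hence so is their product, while
    the product over J n stays bounded. *)
Lemma infinite_prod_seq (K : choiceType) (S : set K) (g : K -> C)
    (J : nat -> {fset K}) :
  complete_for N ->
  (forall n, [set` J n] `<=` S) ->
  (forall n m, (n <= m)%N -> (J n `<=` J m)%fset) ->
  (forall e, 0 < e ->
     exists M, forall i, S i -> i \notin J M -> N (g i - 1) < e) ->
  cvgto (fun n => \prod_(i <- enum_fset (J n)) g i) (infinite_prod N S g).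
Proof.
move=> complN JS Jmono gJ; apply: (finset_lim_seq ultraN) => // e e0.
have rest M (J' : {fset K}) d : 0 <= d <= 1 -> [set` J'] `<=` S ->
    (forall i, S i -> i \notin J M -> N (g i - 1) < d) ->
    N (\prod_(i <- enum_fset J' | i \notin J M) g i - 1) <= d.
  move=> d01 J'S gd; rewrite -big_filter; apply: abs_prod_near1 => // i.
  by rewrite mem_filter => /andP[iM iJ']; rewrite ltW // gd //; apply: J'S.
have [M0 gM0] := gJ 1 ltr01.
pose P n := \prod_(i <- enum_fset (J n)) g i.
pose B := N (P M0) + 1.
have B0 : 0 < B by rewrite ltr_wpDl ?(ultra_ge0 ultraN).
have PB n : (M0 <= n)%N -> N (P n) < B.
  move=> Mn; apply: (@le_lt_trans _ _ (N (P M0))); last by rewrite ltrDl.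
  rewrite /P (big_fset_split _ _ (Jmono _ _ Mn)) normM ler_piMr ?(ultra_ge0 ultraN) //.
  set p := \big[_/_]_(_ <- _ | _) _.
  rewrite -[p](subrK 1); apply: le_trans (ultraD ultraN _ _) _.
  by rewrite ge_max abs1 lexx andbT rest // ler01 lexx.
pose d := Num.min 1 (e / B).
have d0 : 0 < d by rewrite lt_min ltr01 divr_gt0.
have [M gM] := gJ d d0; exists (maxn M0 M) => J' J'S sub.
rewrite (big_fset_split _ _ sub) /= -/(P _) -[X in _ - X]mulr1 -mulrBr normM.
have gmax i : S i -> i \notin J (maxn M0 M) -> N (g i - 1) < d.
  move=> Si iM; apply: gM => //; apply: contra iM.
  exact/fsubsetP/Jmono/leq_maxr.
have d01 : 0 <= d <= 1 by rewrite ltW //= ge_min lexx.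
apply: (@le_lt_trans _ _ (N (P (maxn M0 M)) * d)).
  by apply: ler_wpM2l; rewrite ?(ultra_ge0 ultraN) // rest.
apply: (@lt_le_trans _ _ (B * d)); first by rewrite ltr_pM2r // PB // leq_maxl.
by rewrite mulrC -ler_pdivlMr // ge_min lexx orbT.
Qed.

Lemma cvgto_cancel u r l : cvgto u l -> l != 0 ->
  cvgto (fun n => r n * u n) 0 -> cvgto r 0.
Proof.
move=> ul lin_map0 ru e e0; have [M uM] := ul _ (abs_gt0 lin_map0).
have [M' rM] := ru (e * N l) (mulr_gt0 e0 (abs_gt0 lin_map0)).
exists (maxn M M') => n; rewrite geq_max => /andP[Mn M'n].
have := rM n M'n; rewrite !subr0 normM (ultra_dominant ultraN (uM n Mn)).
by rewrite ltr_pM2r // abs_gt0.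
Qed.

(** Newton interpolation with moving nodes: dividing by X - y n m lowers the
    degree, and the quotient still tends to 0 at the remaining nodes because
    these stay away from y n m. *)
Lemma coef_cvgto0 m (p : nat -> {poly C}) (y : nat -> nat -> C) (z : nat -> C) :
  (forall n, (size (p n) <= m)%N) ->
  (forall k, cvgto (fun n => y n k) (z k)) ->
  (forall k k', z k = z k' -> k = k') ->
  (forall k, (k < m)%N -> cvgto (fun n => (p n).[y n k]) 0) ->
  forall i, cvgto (fun n => (p n)`_i) 0.
Proof.
move=> + yz zinj; elim: m p => [|m IH] p sp py i.
  have p0 n : p n = 0 by apply/eqP; rewrite -size_poly_leq0 sp.
  under eq_fun do rewrite p0 coef0.
  exact: cvgto_cst.
pose c n := (p n).[y n m].
(* The divided difference of p n at the last node. *)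
pose r n := (p n - (c n)%:P) %/ ('X - (y n m)%:P).
have pr n : p n = r n * ('X - (y n m)%:P) + (c n)%:P.
  by rewrite divpK ?subrK // dvdp_XsubCl rootE !hornerE subrr.
have sr n : (size (r n) <= m)%N.
  rewrite size_divp ?polyXsubC_eq0 // size_XsubC leq_subLR add1n.
  apply: leq_trans (size_polyD _ _) _; rewrite size_polyN geq_max sp.
  by apply: leq_trans (size_polyC_leq1 _) _.
have c0 : cvgto c 0 by apply: py.
have {sr}IH : forall i', cvgto (fun n => (r n)`_i') 0.
  apply: IH => // k km.
  apply: (@cvgto_cancel (fun n => y n k - y n m) _ (z k - z m)).
  - exact: cvgtoB.
  - by rewrite subr_eq0; apply: contraTneq km => /zinj ->; rewrite ltnn.
  apply: (@cvgto_eq _ _ _ _ (fun n => (p n).[y n k] - c n)).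
    by move=> n; rewrite [in RHS]pr !hornerE; ring.
  by rewrite -(subr0 0); apply: cvgtoB => //; apply: py; rewrite ltnS ltnW.
have pi n : (p n)`_i =
    (if i is i'.+1 then (r n)`_i' else 0) - (r n)`_i * y n m +
    (if i is i'.+1 then 0 else c n).
  by rewrite pr coefD mulrBr coefB coefMX coefMC coefC; case: (i).
under eq_fun do rewrite pi.
apply: (@cvgto_eql _ _ _ _ (0 - 0 + 0)); first by rewrite subr0 addr0.
apply: cvgtoD => //; last by case: (i) => // i'; apply: cvgto_cst.
apply: cvgtoB => //; first by case: (i) => // i'; apply: cvgto_cst.
by apply: (cvgto0M ultraN abs_subM) => //; apply: yz.
Qed.
End AbsoluteValue.

(** * Passage to the limit *)

Lemma sum_size_wide (V : nmodType) (B : nzSemiRingType) (f : {poly B}) n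
    (g : nat -> V) : (size f <= n)%N ->
  (forall i, (size f <= i)%N -> g i = 0) ->
  \sum_(i < size f) g i = \sum_(i < n) g i.
Proof.
move=> fn g0; rewrite (big_ord_widen n g fn) big_mkcond /=.
by apply: eq_bigr => i _; case: ltnP => // /g0.
Qed.

Section FunctionalEquation.
Variables (R : realType) (F : finFieldType) (C : fieldType) (N : C -> R).
Hypothesis absN : absolute_value N.
Hypothesis complN : complete_for N.
Variable iota : {rmorphism F -> C}.
Variables (A : comNzRingType) (kA : {rmorphism F -> A}) (j : {rmorphism A -> C}).
Hypothesis j_inj : injective j.
Hypothesis jkA : forall c, j (kA c) = iota c.
Local Notation q := #|F|.
Local Notation span := (span kA).
Local Notation indep := (indep kA).
Let ultraN : ultrametric N := absN.1.
Let normM x y : N (x * y) = N x * N y := absN.2 x y.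

Variables (I : set A) (rho : C).
Hypothesis rho0 : rho != 0.
Let l (b : A) : C := rho * j b.
Variable s : nat -> seq A.
Hypothesis s_indep : forall n, indep (s n).
Hypothesis s_sub : forall n b, b \in span (s n) -> I b.
Hypothesis s_mono : forall n m, (n <= m)%N -> {subset span (s n) <= span (s m)}.
Hypothesis s_large : forall r, exists n, forall b, I b -> b \notin span (s n) ->
  r < N (l b).
Local Notation expV := (expV F l).
Local Notation Lat := [set rho * j b | b in I].
Local Notation expL := (exp_lattice N Lat).

Lemma l_lin c b b' : l (kA c * b + b') = iota c * l b + l b'.
Proof. by rewrite /l rmorphD rmorphM jkA; ring. Qed.

Lemma l_inj : injective l.
Proof. by move=> x y /(mulfI rho0) /j_inj. Qed.

Lemma s_inv_small r : 0 < r -> exists n, forall b, I b -> b \notin span (s n) ->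
  N (l b)^-1 < r.
Proof.
move=> r0; have [n nP] := s_large r^-1; exists n => b Ib bn.
have lb := nP b Ib bn; have lb0 : 0 < N (l b) by apply: lt_trans lb; rewrite invr_gt0.
by rewrite absV // -[r]invrK ltf_pV2 // posrE invr_gt0.
Qed.

Lemma expV_cvg x : cvgto N (fun n => expV (s n) x) (expL x).
Proof.
pose J n := [fset y in [seq l b | b <- span (s n) & b != 0]]%fset.
have memJ n y : reflect (exists2 b, b \in span (s n) /\ b != 0 & y = l b)
    (y \in J n).
  rewrite inE /=; apply: (iffP mapP) => [[b]|[b [bs b0] ->]].
    by rewrite mem_filter => /andP[b0 bs] ->; exists b.
  by exists b; rewrite // mem_filter b0.
apply: (@cvgto_eq _ _ _ _
    (fun n => x * \prod_(y <- enum_fset (J n)) (1 - x / y))).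
  move=> n; rewrite big_fset_seq; last first.
    by rewrite map_inj_uniq ?filter_uniq ?span_uniq //; apply: l_inj.
  rewrite (expV_prod l_lin l_inj) //; congr (_ * _).
  rewrite big_map big_filter [RHS]big_mkcond /=; apply: eq_bigr => b _.
  by case: eqVneq => //= ->; rewrite (lin_map0 l_lin) invr0 mulr0 subr0.
apply: (cvgtoM ultraN (abs_subM absN)); first exact: cvgto_cst.
apply: infinite_prod_seq => //.
- move=> n y /memJ [b [bs b0] ->]; split; last exact: (lin_map_neq0 l_lin l_inj).
  by exists b => //; apply: s_sub bs.
- move=> n m nm; apply/fsubsetP => y /memJ [b [bs b0] ->].
  by apply/memJ; exists b => //; split=> //; apply: s_mono bs.
move=> e e0; have [|n nP] := @s_inv_small (e / (N x + 1)).
  by rewrite divr_gt0 // ltr_wpDl // ultra_ge0.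
have x1 : 0 < N x + 1 by rewrite ltr_wpDl // ultra_ge0.
exists n => _ [[b Ib <-] b0] bJ; rewrite addrAC subrr add0r ultra_opp // normM.
apply: (@le_lt_trans _ _ ((N x + 1) * N (l b)^-1)).
  by apply: ler_wpM2r; rewrite ?ultra_ge0 // lerDl.
rewrite mulrC -ltr_pdivlMr //; apply: nP => //.
apply: contra bJ => bs; apply/memJ; exists b => //; split=> //.
by apply: contraNneq b0 => ->; rewrite rmorph0 mulr0.
Qed.

Variables (gap : R) (gap_gt0 : 0 < gap).
Hypothesis gap_le : forall b, I b -> b != 0 -> gap <= N (l b).

(** For x closer to 0 than any nonzero lattice point, all factors of the product
    have norm 1. *)
Lemma expL_isometry x : N x < gap -> N (expL x) = N x.
Proof.
move=> xe; have Ex n : N (expV (s n) x) = N x.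
  rewrite (expV_prod l_lin l_inj) // normM -[RHS]mulr1; congr (_ * _).
  rewrite big_seq; apply: (@big_ind _ (fun p => N p = 1)).
  - exact: abs1.
  - by move=> y z; rewrite normM => -> ->; rewrite mulr1.
  move=> b bs; rewrite -[RHS](abs1 absN); apply: (ultra_dominant ultraN).
  rewrite addrAC subrr add0r ultra_opp // normM abs1 // absV //.
  have [->|b0] := eqVneq b 0.
    by rewrite (lin_map0 l_lin) (ultra0 ultraN) invr0 mulr0 ltr01.
  have lb := gap_le (s_sub bs) b0.
  by rewrite ltr_pdivrMr ?(lt_le_trans gap_gt0) // mul1r (lt_le_trans xe).
have [x0|x0] := eqVneq x 0.
  by rewrite x0 /exp_lattice mul0r.
have [M xM] := expV_cvg x (abs_gt0 absN x0).
rewrite -(Ex M); apply: (ultra_dominant ultraN).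
by rewrite (ultra_sym ultraN) Ex xM.
Qed.

Variables (cC : F -> C) (cA : F -> A).
Hypotheses (cCE : cC =1 iota) (cAE : cA =1 kA).
Variable T : completed_tensor N cC cA.
Variable tV : T -> T.
Hypothesis tVP : tau_inv q tV.
Hypothesis rootC : forall c : C, exists y, y ^+ q = c.
Local Notation L := (ct_left T).
Local Notation Rr := (ct_right T).
Local Notation NT := (ct_norm T).
Let ultraT : ultrametric NT := ct_ultrametric T.
Let subT : forall x y, NT (x * y) <= NT x * NT y := @ct_normM _ _ _ _ _ _ _ T.

Lemma balanced c : L (iota c) = Rr (kA c).
Proof. by rewrite -cCE -cAE ct_balanced. Qed.

(** An element b <> 0 is by itself an F-free family. *)
Lemma ct_norm_pure c b : b != 0 -> NT (L c * Rr b) = N c.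
Proof.
move=> b0; have := @ct_sup_norm _ _ _ _ _ _ _ T 1 (fun=> b) (fun=> c).
rewrite big_ord1 big_ord_recl big_ord0 => -> => [|k].
  by rewrite max_l // ultra_ge0.
rewrite big_ord1 cAE => /(congr1 j)/eqP; rewrite rmorphM jkA rmorph0 mulf_eq0.
rewrite fmorph_eq0 => /orP[/eqP k0 i|/eqP jb]; first by rewrite ord1.
by rewrite (j_inj (etrans jb (esym (rmorph0 j)))) eqxx in b0.
Qed.

Lemma ct_norm_left c : NT (L c) = N c.
Proof. by rewrite -(ct_norm_pure c (oner_neq0 A)) rmorph1 mulr1. Qed.

Lemma frob_inj : injective (fun c : C => c ^+ q).
Proof.
move=> x y /= xy; have e : (x - y) ^+ q = 0 by rewrite (frobB iota) xy subrr.
by apply/eqP; rewrite -subr_eq0; move/eqP: e; rewrite expf_eq0 => /andP[].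
Qed.

Lemma frob_qroot (c : C) : qroot q c ^+ q = c.
Proof. exact: (@xgetPex C 0 [set y | y ^+ q = c] (rootC c)). Qed.

Lemma tV_add x y : tV (x + y) = tV x + tV y.
Proof. by case: tVP. Qed.

Lemma tV_right a x : tV (Rr a * x) = Rr a * tV x.
Proof. by case: tVP => _ + _ _ => /(_ a x); rewrite /tensor rmorph1 mul1r. Qed.

Lemma tV_const (c : C) : tV (L c) = L (qroot q c).
Proof. by case: tVP => _ _ + _ => /(_ c); rewrite /tensor !rmorph1 !mulr1. Qed.

Lemma tV_cvg u x : cvgto NT u x -> cvgto NT (fun n => tV (u n)) (tV x).
Proof.
move=> ux e e0; case: tVP => _ _ _ /(_ x e e0) [d d0 dP].
by have [M uM] := ux d d0; exists M => n /uM /dP.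
Qed.

(** Holds on pure tensors, hence everywhere by density and continuity. *)
Lemma tV_left c x : tV (L (c ^+ q) * x) = L c * tV x.
Proof.
have tV0' := tV0 tV_add.
have pure m (d : 'I_m -> C) (b : 'I_m -> A) :
    tV (L (c ^+ q) * \sum_(i < m) L (d i) * Rr (b i)) =
    L c * tV (\sum_(i < m) L (d i) * Rr (b i)).
  rewrite mulr_sumr !(big_morph tV tV_add tV0') mulr_sumr.
  apply: eq_bigr => i _; rewrite mulrA -rmorphM ![_ * Rr _]mulrC !tV_right.
  rewrite !tV_const mulrCA -rmorphM; congr (_ * L _).
  by apply: frob_inj; rewrite exprMn !frob_qroot.
have /choice [u uP] : forall n : nat, exists y : T,
    NT (x - y) < n.+1%:R^-1 /\ tV (L (c ^+ q) * y) = L c * tV y.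
  move=> n; have [|m [d [b xb]]] := @ct_dense _ _ _ _ _ _ _ T x n.+1%:R^-1.
    by rewrite invr_gt0 ltr0Sn.
  by exists (\sum_(i < m) L (d i) * Rr (b i)).
have ux : cvgto NT u x.
  by apply: cvgto_of_inv => n; rewrite (ultra_sym ultraT); case: (uP n).
have ul y z : cvgto NT y z -> cvgto NT (fun n => L c * y n) (L c * z).
  by apply: cvgtoM => //; apply: cvgto_cst.
apply: (cvgto_unique ultraT (u := fun n => tV (L (c ^+ q) * u n))).
  apply: tV_cvg; apply: cvgtoM => //; exact: cvgto_cst.
by apply: (cvgto_eq (fun n => (uP n).2)); apply/ul/tV_cvg.
Qed.
Lemma tV_one : tV 1 = 1.
Proof.
rewrite -(rmorph1 L) tV_const; congr (L _); apply: frob_inj.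
by rewrite /= frob_qroot expr1n.
Qed.

Lemma iter_tV_left i (c : C) x :
  iter i tV (L c * x) = L (iter i (@qroot q C) c) * iter i tV x.
Proof.
elim: i c x => //= i IH c x.
by rewrite IH -tV_left frob_qroot.
Qed.

Lemma iter_tV_cvg i u x :
  cvgto NT u x -> cvgto NT (fun n => iter i tV (u n)) (iter i tV x).
Proof. by move=> ux; elim: i => //= i IH; apply: tV_cvg. Qed.

Lemma iter_tV_frob i c x : iter i tV (L (c ^+ (q ^ i)) * x) = L c * iter i tV x.
Proof.
elim: i c x => [|i IH] c x; first by rewrite expn0 expr1.
by rewrite iterSr expnSr exprM tV_left IH -iterSr.
Qed.

Local Notation zetaV := (zetaV kA l L Rr).

Lemma zetaV_cvg :
  cvgto NT (fun n => zetaV (s n)) (tensor T rho^-1 1 * zeta j T I).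
Proof.
rewrite /tensor rmorph1 mulr1.
pose J n := [fset b in [seq b <- span (s n) | b != 0]]%fset.
apply: (@cvgto_eq _ _ _ _
   (fun n => L rho^-1 * \sum_(b <- enum_fset (J n)) L (j b)^-1 * Rr b)).
  move=> n; rewrite big_fset_seq; last by rewrite filter_uniq // span_uniq.
  rewrite big_filter [in RHS]big_mkcond /= mulr_sumr; apply: eq_bigr => b _.
  case: eqVneq => [->|_]; first by rewrite rmorph0 !mulr0.
  by rewrite mulrA -rmorphM -invfM.
apply: cvgtoM => //; first exact: cvgto_cst.
apply: infinite_sum_seq => //.
- exact: ct_complete.
- move=> n b; rewrite /= inE /= mem_filter => /andP[b0 bs].
  by split=> //; apply: s_sub bs.
- move=> n m nm; apply/fsubsetP => b; rewrite !inE /= !mem_filter.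
  by case/andP=> -> /(s_mono nm).
move=> e e0; have rho_gt0 := abs_gt0 absN rho0.
have [n nP] := s_inv_small (divr_gt0 e0 rho_gt0).
exists n => b [Ib b0] bJ.
rewrite ct_norm_pure //.
have : N (l b)^-1 < e / N rho.
  by apply: nP => //; apply: contra bJ => bs; rewrite inE /= mem_filter b0.
rewrite invfM normM ltr_pdivlMr // absV // mulrAC mulVf ?mul1r // gt_eqF //.
Qed.

Lemma zetaV_perm u u' : indep u -> indep u' -> span u =i span u' ->
  zetaV u = zetaV u'.
Proof.
by move=> iu iu' e; apply/perm_big/uniq_perm => //; apply: span_uniq.
Qed.

Lemma expV_perm u u' y : indep u -> indep u' -> span u =i span u' ->
  expV u y = expV u' y.
Proof.
move=> iu iu' e; rewrite !(expV_prod l_lin l_inj) //; congr (_ * _).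
by apply/perm_big/uniq_perm => //; apply: span_uniq.
Qed.

Section Multiplier.
Variables (a : A) (d : nat) (f : {poly C}) (pi : C).
Hypothesis a0 : a != 0.
Hypothesis pi01 : 0 < N pi < gap.
Hypothesis pi1 : N pi < 1.
Hypothesis s_shift : forall n b, b \in span (s n) -> a * b \in span (s (n + d)).
Hypothesis s_size : forall n, (size (s (n + d)) <= size (s n) + d)%N.
Hypothesis f_size : (size f <= d.+1)%N.
Hypothesis f_exp : forall x, expL (j a * x) = tau_eval q f (expL x).

Lemma ja_neq0 : j a != 0.
Proof. by apply: contra_neq a0 => ja; apply: j_inj; rewrite ja rmorph0. Qed.

Lemma mul_a_inj : injective (fun b => a * b).
Proof.
move=> x y /(congr1 j); rewrite !rmorphM => /(mulfI ja_neq0); exact: j_inj.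
Qed.

Let as_ n := [seq a * b | b <- s n].

Lemma zetaV_scale n : L (j a) * zetaV (as_ n) = Rr a * zetaV (s n).
Proof.
rewrite /zetaV span_scale big_map !mulr_sumr; apply: eq_bigr => b _.
rewrite rmorphM mulrA -rmorphM.
have -> : j a * (l (a * b))^-1 = (l b)^-1.
  by rewrite /l rmorphM mulrCA invfM mulrA divff ?mul1r // ja_neq0.
by rewrite mulrCA.
Qed.

Lemma expV_scale n x : expV (as_ n) (j a * x) = j a * expV (s n) x.
Proof.
rewrite !(expV_prod l_lin l_inj) ?indep_scale //; last exact: mul_a_inj.
rewrite span_scale big_map -mulrA; congr (_ * (_ * _)); apply: eq_bigr => b _.
by rewrite /l rmorphM mulrCA -mulf_div divff ?mul1r // ja_neq0.
Qed.

(** The operator is that of a V_n inside V_(n+d), rescaled by a: the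
    exponential of a V_n at a y is a times the exponential of V_n at y. *)
Lemma filtration_quotient : exists c : nat -> nat -> C,
  (forall n x, expV (s (n + d)) (j a * x) =
     \sum_(i < d.+1) c n i * expV (s n) x ^+ (q ^ i)) /\
  (forall n, \sum_(i < d.+1) iter i tV (L (c n i) * zetaV (s (n + d))) =
     Rr a * zetaV (s n)).
Proof.
have as_indep n : indep (as_ n) by rewrite indep_scale //; exact: mul_a_inj.
have /choice [t tP] : forall n, exists t,
    [/\ (size t <= d)%N, indep (t ++ as_ n) &
        span (t ++ as_ n) =i span (s (n + d))].
  move=> n; have [b|t ti ts] := span_extend (s' := s (n + d)) (as_indep n).
    by rewrite span_scale => /mapP [b' bs ->]; apply: s_shift.
  exists t; split=> //; have sub : {subset span (t ++ as_ n) <= span (s (n + d))}.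
    by move=> b; rewrite ts.
  have := leq_trans (size_indep_sub ti sub) (s_size n).
  by rewrite size_cat size_map addnC leq_add2l.
exists (fun n i => quot_coef F l (t n) (as_ n) i * j a ^+ (q ^ i)).
split=> n => [x|]; have [td ti ts] := tP n.
  rewrite -(expV_perm _ ti (s_indep _) ts) (expV_quot iota _ _ _ td).
  by apply: eq_bigr => i _; rewrite expV_scale exprMn mulrA.
rewrite -zetaV_scale -(zetaV_perm ti (s_indep _) ts).
rewrite -(zetaV_quot l_lin l_inj balanced tV_add tV_one tV_left tV_right td ti).
rewrite mulr_sumr; apply: eq_bigr => i _.
by rewrite [_ * j a ^+ _]mulrC rmorphM -mulrA iter_tV_frob.
Qed.

(** The polynomials with these coefficients have degree at most q^d, and their
    values at the points E_(V_n)(x) tend to those of f.  The points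
    x = pi^(k+1) are chosen since the exponential takes values of distinct norms
    there. *)
Lemma quotient_cvg (c : nat -> nat -> C) :
  (forall n x, expV (s (n + d)) (j a * x) =
     \sum_(i < d.+1) c n i * expV (s n) x ^+ (q ^ i)) ->
  forall i, (i < d.+1)%N -> cvgto N (fun n => c n i) f`_i.
Proof.
move=> cP i id1.
pose p n := \sum_(k < d.+1) (c n k - f`_k) *: 'X^(q ^ k).
have cE n : c n i = (p n)`_(q ^ i) + f`_i.
  rewrite coef_sum (bigD1 (Ordinal id1)) //= coefZ coefXn eqxx mulr1.
  rewrite big1 ?addr0 ?subrK // => k ki; rewrite coefZ coefXn.
  case: eqVneq => [|_]; last by rewrite mulr0.
  move/(expnI (finNzRing_gt1 F)) => ik; case/eqP: ki.
  by apply: val_inj; rewrite /= ik.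
apply: (cvgto_eq cE); apply: (@cvgto_eql _ _ _ _ (0 + f`_i)); first exact: add0r.
apply: cvgtoD => //; last exact: cvgto_cst.
case/andP: pi01 => pi0 pie.
have pik k : N (pi ^+ k.+1) < gap.
  rewrite absX // exprS; apply: le_lt_trans pie.
  by rewrite ler_piMr ?exprn_ile1 ?ultra_ge0 // ltW.
apply: (coef_cvgto0 absN (m := (q ^ d).+1) (y := fun n k => expV (s n) (pi ^+ k.+1))
  (z := fun k => expL (pi ^+ k.+1))).
- move=> n; apply: leq_trans (size_sum _ _ _) _; apply/bigmax_leqP => k _.
  apply: leq_trans (size_scale_leq _ _) _; rewrite size_polyXn ltnS.
  by rewrite leq_exp2l ?finNzRing_gt1 // -ltnS.
- by move=> k; apply: expV_cvg.
- move=> k k' /(congr1 N); rewrite !expL_isometry // !absX //.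
  by move/(ieexprIn pi0 (negbT (lt_eqF pi1)))=> [].
move=> k _; set x := pi ^+ k.+1.
apply: (@cvgto_eq _ _ _ _ (fun n => expV (s (n + d)) (j a * x) -
   \sum_(i < d.+1) f`_i * expV (s n) x ^+ (q ^ i))).
  move=> n; rewrite cP -sumrB horner_sum; apply: eq_bigr => h _.
  by rewrite !hornerE mulrBl.
apply: (@cvgto_eql _ _ _ _ (expL (j a * x) -
   \sum_(i < d.+1) f`_i * expL x ^+ (q ^ i))).
  rewrite f_exp /tau_eval (sum_size_wide (f := f) (n := d.+1)
    (g := fun i => f`_i * expL x ^+ (q ^ i))) ?subrr // => h fh.
  by rewrite nth_default // mul0r.
apply: cvgtoB => //; first exact: (cvgto_shift (u := fun n => expV (s n) _) d (expV_cvg _)).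
apply: cvgto_sum => // h; apply: (cvgtoM ultraN (abs_subM absN)).
  exact: cvgto_cst.
by apply: (cvgtoX ultraN (abs_subM absN)); apply: expV_cvg.
Qed.

Lemma zeta_eigen :
  tau_inv_act tV (adjoint q f) (tensor T rho^-1 1 * zeta j T I) =
  tensor T 1 a * (tensor T rho^-1 1 * zeta j T I).
Proof.
set xi := tensor T rho^-1 1 * _.
have [c [cexp czeta]] := filtration_quotient; have cf := quotient_cvg cexp.
have -> : tensor T 1 a * xi = Rr a * xi by rewrite /tensor rmorph1 mul1r.
have -> : tau_inv_act tV (adjoint q f) xi =
    \sum_(i < d.+1) iter i tV (L f`_i * xi).
  rewrite /tau_inv_act (sum_size_wide (f := adjoint q f) (n := d.+1)
    (g := fun i => tensor T (adjoint q f)`_i 1 * iter i tV xi)); last first.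
  - by move=> i fi; rewrite nth_default // /tensor rmorph0 !mul0r.
  - by apply: leq_trans f_size; apply: size_poly.
  apply: eq_bigr => i _; rewrite iter_tV_left /tensor rmorph1 mulr1 coef_poly.
  case: ltnP => // fi; rewrite nth_default //.
  have q0 : qroot q (0 : C) = 0.
    by apply: frob_inj; rewrite /= frob_qroot expr0n eqn0Ngt finField_card_gt0.
  have -> : iter i (@qroot q C) 0 = 0 by elim: (i : nat) => //= i' ->.
  by [].
apply: (cvgto_unique ultraT (u := fun n =>
    \sum_(i < d.+1) iter i tV (L (c n i) * zetaV (s (n + d))))).
  apply: cvgto_sum => // i; apply: iter_tV_cvg; apply: (cvgtoM ultraT subT).
    move=> e e0; have [M cM] := cf i (ltn_ord i) e e0; exists M => n Mn.
    by rewrite -rmorphB ct_norm_left cM.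
  exact: (cvgto_shift (u := fun n => zetaV (s n)) d zetaV_cvg).
apply: (cvgto_eq czeta); apply: (cvgtoM ultraT subT); first exact: cvgto_cst.
exact: zetaV_cvg.
Qed.
End Multiplier.
End FunctionalEquation.

(** * Exhaustion by finite spaces, and roots in a completion *)

Section Filtration.
Variables (F : finFieldType) (A : comNzRingType) (kA : {rmorphism F -> A}).
Variable W : nat -> A -> Prop.
Hypothesis W_lin : forall n, lin_closed kA (W n).
Hypothesis W_zero : forall b, W 0%N b -> b = 0.
Hypothesis W_mono : forall n b, W n b -> W n.+1 b.
Hypothesis W_step : forall n b b', W n.+1 b -> ~ W n b -> W n.+1 b' ->
  exists c, W n (b' - kA c * b).

(** Each step of the filtration adds at most one line. *)
Lemma filtration_basis : exists s : nat -> seq A,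
  [/\ forall n, indep kA (s n),
      forall n b, b \in span kA (s n) <-> W n b &
      forall n d, (size (s (n + d)) <= size (s n) + d)%N].
Proof.
pose P n s := indep kA s /\ forall b, b \in span kA s <-> W n b.
have step (ns : nat * seq A) : exists s', P ns.1 ns.2 ->
    P ns.1.+1 s' /\ (size s' <= (size ns.2).+1)%N.
  case: ns => n s /=.
  have [[b [Wb Wb']]|noW] := pselect (exists b, W n.+1 b /\ ~ W n b); last first.
    exists s => -[si sW]; split=> //; split=> // b; rewrite sW.
    split; first exact: W_mono.
    by move=> Wb; apply: contrapT => Wb'; apply: noW; exists b.
  exists (b :: s) => -[si sW]; split=> //; split=> [|b'].
    by rewrite /= si andbT; apply/negP => /sW.
  split.
    by apply: (span_min (W_lin n.+1) Wb) => b'' /sW; apply: W_mono.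
  move=> /(W_step Wb Wb') [c /sW cs].
  by apply/mem_span_cons; exists c, (b' - kA c * b); rewrite // addrC subrK.
have [g gP] := choice step.
pose s := fix s n := if n is m.+1 then g (m, s m) else [::].
have sP n : P n (s n).
  elim: n => [|n IH]; last exact: (gP (n, s n) IH).1.
  split=> // b; rewrite inE; split=> [/eqP->|/W_zero -> //].
  by case: (W_lin 0).
exists s; split=> [n|n b|n d]; [by case: (sP n)|by case: (sP n)|].
elim: d => [|d IH]; first by rewrite !addn0.
rewrite !addnS; apply: leq_trans (gP (_, s (n + d)%N) (sP _)).2 _.
by rewrite ltnS.
Qed.
End Filtration.

(** Roots of approximations in the algebraically closed field form a Cauchy
    sequence because x |-> x^q is additive and raises norms to the
    q-th power. *)
Lemma completion_root (F : finFieldType) (R : realType) (E : closedFieldType)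
    (N : E -> R) (C : completion N) (iota : {rmorphism F -> C}) (c : C) :
  exists y, y ^+ #|F| = c.
Proof.
have absN := cpl_abs C; have ultraN := absN.1.
have /choice [u uP] : forall n : nat, exists y : C,
    cpl_norm C (y ^+ #|F| - c) < n.+1%:R^-1.
  move=> n; have [|x cx] := @cpl_dense _ _ _ C c n.+1%:R^-1.
    by rewrite invr_gt0 ltr0Sn.
  have [r rx] := @solve_monicpoly E #|F| (fun i => if i is 0%N then x else 0)
    (finField_card_gt0 F).
  exists (cpl_in C r); rewrite -rmorphXn rx (card_predK F) big_ord_recl big1.
    by rewrite expr0 mulr1 addr0 (ultra_sym ultraN).
  by move=> i _; rewrite mul0r.
have uc : cvgto (cpl_norm C) (fun n => u n ^+ #|F|) c.
  exact: cvgto_of_inv.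
have [|y uy] := @cpl_complete _ _ _ C u.
  move=> e e0; have [M uM] := uc (e ^+ #|F|) (exprn_gt0 _ e0).
  exists M => m n Mm Mn; rewrite -(ltr_pXn2r (finField_card_gt0 F)) ?nnegrE;
    rewrite ?(ultra_ge0 ultraN) ?(ltW e0) //.
  rewrite -(absX absN) (frobB iota); apply: (ultra_trans ultraN (z := c)).
    exact: uM.
  by rewrite (ultra_sym ultraN) uM.
exists y; apply: (cvgto_unique ultraN _ uc).
exact: (cvgtoX ultraN (abs_subM absN)).
Qed.

(** * The affine ring and its valuation *)

Section AffineRing.
Variables (F : finFieldType) (X : projective_variety F) (K : function_field X).
Variable oo : rational_point X.

Lemma ar_const_zmod_morphism : zmod_morphism (@ar_const F X K oo).
Proof. by move=> x y; apply: val_inj; rewrite /= rmorphB. Qed.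

Lemma ar_const_monoid_morphism : monoid_morphism (@ar_const F X K oo).
Proof. by split=> [|x y]; apply: val_inj; rewrite /= ?rmorph1 ?rmorphM. Qed.

HB.instance Definition _ := GRing.isZmodMorphism.Build F (affine_ring K oo)
  (@ar_const F X K oo) ar_const_zmod_morphism.
HB.instance Definition _ := GRing.isMonoidMorphism.Build F (affine_ring K oo)
  (@ar_const F X K oo) ar_const_monoid_morphism.

Variable v : K -> int.
Hypothesis v_oo : valuation_at oo v.

Lemma val_mul x y : x != 0 -> y != 0 -> v (x * y) = v x + v y.
Proof. by case: v_oo => + _ _ _; apply. Qed.

Lemma val_one : v 1 = 0.
Proof.
have := val_mul (oner_neq0 K) (oner_neq0 K); rewrite mulr1 => /eqP.
by rewrite -subr_eq0 opprD addNKr oppr_eq0 => /eqP.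
Qed.

Lemma val_const c : c != 0 -> v (ff_const K c) = 0.
Proof.
have ge0 e : e != 0 -> 0 <= v (ff_const K e).
  move=> e0; case: v_oo => _ _ _ reg; apply/reg; first by rewrite fmorph_eq0.
  exact: regular_at_const.
move=> c0; have := val_mul (x := ff_const K c) (y := ff_const K c^-1).
rewrite !fmorph_eq0 invr_eq0 -rmorphM divff // rmorph1 val_one => /(_ c0 c0).
by have := ge0 _ c0; have := ge0 c^-1; rewrite invr_eq0 => /(_ c0); lia.
Qed.

Lemma val_exp x n : x != 0 -> v (x ^+ n) = v x *+ n.
Proof.
move=> x0; elim: n => [|n IH]; first by rewrite val_one.
by rewrite exprS val_mul ?expf_neq0 // IH mulrS.
Qed.

Lemma val_inv x : x != 0 -> v x^-1 = - v x.
Proof.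
move=> x0; have := val_mul x0 (invr_neq0 x0); rewrite divff // val_one.
by move/esym/eqP; rewrite addr_eq0 => /eqP ->; rewrite opprK.
Qed.

Lemma val_expz x (m : int) : x != 0 -> v (x ^ m) = v x * m.
Proof.
move=> x0; case: m => n; first by rewrite -exprnP val_exp // -mulr_natr natz.
by rewrite NegzE -exprnN val_inv ?expf_neq0 // val_exp // mulrN -mulr_natr natz.
Qed.

(** Unlike k <= v x alone, this is meaningful at x = 0, where v is arbitrary. *)
Definition vge (k : int) (x : K) : Prop := x = 0 \/ k <= v x.

Lemma vge_lin k c x y : vge k x -> vge k y -> vge k (ff_const K c * x + y).
Proof.
have [->|c0] := eqVneq c 0; first by rewrite rmorph0 mul0r add0r.
have ic : ff_const K c != 0 by rewrite fmorph_eq0.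
case=> [->|kx]; first by rewrite mulr0 add0r.
case=> [->|ky].
  rewrite addr0; have [->|x0] := eqVneq x 0; first by rewrite mulr0; left.
  by right; rewrite val_mul // val_const // add0r.
have [->|x0] := eqVneq x 0; first by rewrite mulr0 add0r; right.
have [->|y0] := eqVneq y 0.
  by rewrite addr0; right; rewrite val_mul // val_const // add0r.
have [s0|s0] := eqVneq (ff_const K c * x + y) 0; [by left|right].
case: v_oo => _ vD _ _; apply: le_trans (vD _ _ _ y0 s0); rewrite ?mulf_neq0 //.
by rewrite le_min val_mul // val_const // add0r kx ky.
Qed.

Lemma vge_mono k k' x : k' <= k -> vge k x -> vge k' x.
Proof. by move=> kk [->|kx]; [left|right; apply: le_trans kx]. Qed.

Variable w : K.
Hypothesis w_unif : uniformizer v w.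

(** The exponent of the leading term is the valuation. *)
Lemma leading_coefficient_val y s : y != 0 -> leading_coefficient v w y s ->
  s != 0 /\ vge (v y + 1) (y - ff_const K s * w ^ (v y)).
Proof.
move=> y0 [s0 [m [c [cs /(_ 1%N)]]]]; rewrite big_ord1 cs addr0 => rP.
have {}rP : vge (m + 1) (y - ff_const K s * w ^ m) by case: rP; [left|right].
split=> //; suff -> : v y = m by [].
case: w_unif => w0 vw1.
have t0 : ff_const K s * w ^ m != 0 by rewrite mulf_neq0 ?fmorph_eq0 // expfz_neq0.
have vt : v (ff_const K s * w ^ m) = m.
  by rewrite val_mul ?fmorph_eq0 ?expfz_neq0 // val_const // add0r val_expz // vw1 mul1r.
apply/le_anti/andP; split.
  rewrite leNgt; apply/negP => my.
  have : vge (m + 1) (ff_const K s * w ^ m).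
    have := vge_lin (-1) rP (_ : vge (m + 1) y).
    rewrite rmorphN rmorph1 mulN1r opprB subrK; apply; right.
    by move: my; lia.
  by case=> [e|]; [rewrite e eqxx in t0|rewrite vt; lia].
have : vge m (ff_const K 1 * (y - ff_const K s * w ^ m) + ff_const K s * w ^ m).
  apply: vge_lin; first by apply: vge_mono rP; lia.
  by right; rewrite vt.
by rewrite rmorph1 mul1r subrK => -[e|//]; rewrite e eqxx in y0.
Qed.

(** The residue field at infinity is F, so that pole orders grow one dimension at
    a time. *)
Lemma leading_coefficient_cancel y y' s s' : y != 0 -> y' != 0 -> v y = v y' ->
  leading_coefficient v w y s -> leading_coefficient v w y' s' ->
  vge (v y + 1) (y' - ff_const K (s' / s) * y).
Proof.
move=> y0 y0' vyy /(leading_coefficient_val y0) [s0 r].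
move=> /(leading_coefficient_val y0') [s0' r'].
rewrite -vyy in r'; have := vge_lin (- (s' / s)) r r'.
have -> : ff_const K (- (s' / s)) * (y - ff_const K s * w ^ v y) +
   (y' - ff_const K s' * w ^ v y) = y' - ff_const K (s' / s) * y +
   (ff_const K (s' / s) * ff_const K s - ff_const K s') * w ^ v y.
  by rewrite rmorphN; ring.
by rewrite -rmorphM divfK // subrr mul0r addr0.
Qed.
End AffineRing.

(** * The eigenvector property of the zeta function *)

Lemma subz_le_nat (M n m : nat) : (n <= m)%N -> M%:Z - m%:Z <= M%:Z - n%:Z.
Proof. lia. Qed.

Lemma subz_squeeze (M n : nat) (x : int) : M%:Z - n.+1%:Z <= x ->
  ~ (M%:Z - n%:Z <= x) -> x = M%:Z - n.+1%:Z.
Proof. by move=> ? /negP; lia. Qed.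

Lemma subzS (M n : nat) : M%:Z - n.+1%:Z + 1 = M%:Z - n%:Z.
Proof. lia. Qed.

Lemma subzDK (M k : nat) : M%:Z - (M + k)%N%:Z = - k%:Z.
Proof. lia. Qed.

Lemma subz_shift (M n d : nat) (x : int) : M%:Z - n%:Z <= x ->
  M%:Z - (n + d)%N%:Z <= - d%:Z + x.
Proof. lia. Qed.

Lemma size_exponent (n : nat) (x : int) : (0 < n)%N -> n%:Z = - x + 1 ->
  exists d : nat, x = - d%:Z.
Proof. by exists n.-1; lia. Qed.

Lemma size_natz (n d : nat) : n%:Z = d%:Z + 1 -> (n <= d.+1)%N.
Proof. lia. Qed.

Theorem theoremD
  (F : finFieldType) (X : projective_variety F) (K : function_field X)
  (X_geom_irr : geometrically_irreducible X)
  (X_dim : one_dimensional K)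
  (X_smooth : smooth_of_dim X 1)
  (oo : rational_point X)
  (v : K -> int) (v_oo : valuation_at oo v)
  (w : K) (w_unif : uniformizer v w)
  (sgn : affine_ring K oo -> F)
  (sgnP : forall a, a != 0 -> leading_coefficient v w (ar_val a) (sgn a))
  (R : realType)
  (Kinf : completion (absK R v))
  (Kinfbar : algebraic_closure (cpl_norm Kinf))
  (Cinf : completion (ac_norm Kinfbar))
  (A := affine_ring K oo)
  (emb : K -> Cinf := @tower_in R K (absK R v) Kinf Kinfbar Cinf)
  (j : A -> Cinf := fun a => emb (ar_val a))
  (T : completed_tensor (cpl_norm Cinf)
         (fun c : F => emb (ff_const K c)) (@ar_const F X K oo))
  (tauV : T -> T) (tauVP : tau_inv #|F| tauV)
  (phi : A -> {poly Cinf})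
  (phi_drinfeld : normalized_drinfeld #|F| j (ar_deg v)
                    (fun a => emb (ff_const K (sgn a))) phi)
  (I : set A) (I_ideal : is_ideal I) (I_neq0 : exists2 b, I b & b != 0)
  (rho : Cinf) (rho_neq0 : rho != 0)
  (phi_lattice : period_lattice #|F| (cpl_norm Cinf) j phi
                   [set rho * j b | b in I])
  (a : A) :
  tau_inv_act tauV (adjoint #|F| (phi a)) (tensor T rho^-1 1 * zeta j T I) =
  tensor T 1 a * (tensor T rho^-1 1 * zeta j T I).
Proof.
have card1 : (1 : R) < #|F|%:R by rewrite ltr1n finNzRing_gt1.
have card0 : (0 : R) < #|F|%:R by apply: lt_trans card1.
have absC := cpl_abs Cinf; have ultraC := absC.1.
have complC := @cpl_complete _ _ _ Cinf.
pose embr : {rmorphism K -> Cinf} := cpl_in Cinf \o (ac_in Kinfbar \o cpl_in Kinf).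
pose jr : {rmorphism A -> Cinf} := embr \o (\val : A -> K).
pose iota : {rmorphism F -> Cinf} := embr \o ff_const K.
pose kA : {rmorphism F -> A} := @ar_const F X K oo.
have normE x : cpl_norm Cinf (embr x) = absK R v x.
  by rewrite /= cpl_isometry ac_extends cpl_isometry.
have arv_neq0 (b : A) : b != 0 -> ar_val b != 0.
  by apply: contra_neq => b0; apply: val_inj.
have norm_j b : b != 0 -> cpl_norm Cinf (jr b) = #|F|%:R ^ (- v (ar_val b)).
  by move=> b0; rewrite normE /absK (negPf (arv_neq0 b b0)).
have j_inj : injective jr by move=> x y /fmorph_inj /val_inj.
have [[phi1 phiD phiM] phiP] := phi_drinfeld.
have [_ disc _ phi_exp] := phi_lattice.
have [I0 ID IM] := I_ideal.
have [a0|a0] := eqVneq a 0.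
  have phi0 : phi 0 = 0.
    by have /eqP := phiD 0 0; rewrite addr0 -subr_eq0 opprD addNKr oppr_eq0 => /eqP.
  rewrite a0 phi0 /tensor rmorph0 mulr0 mul0r /tau_inv_act /adjoint.
  by rewrite size_poly0 poly_def big_ord0 size_poly0 big_ord0.
have [gap gap_gt0 gap_le] : exists2 e : R, 0 < e &
    forall b, I b -> b != 0 -> e <= cpl_norm Cinf (rho * jr b).
  have j0 : j 0 = 0 := rmorph0 jr.
  have [|e e0 eP] := disc 0; first by exists 0 => //; rewrite j0 mulr0.
  exists e => // b Ib b0; rewrite leNgt; apply/negP => lb.
  have := eP (rho * jr b) (ex_intro2 _ _ b Ib erefl).
  rewrite subr0 => /(_ lb)/eqP; rewrite mulf_eq0 (negPf rho_neq0) /=.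
  by rewrite !fmorph_eq0 (negPf (arv_neq0 b b0)).
have norm_l b : b != 0 ->
    cpl_norm Cinf (rho * jr b) = cpl_norm Cinf rho * #|F|%:R ^ (- v (ar_val b)).
  by move=> b0; rewrite absC.2 norm_j.
have rho_gt0 := abs_gt0 absC rho_neq0.
have pow_large r : exists n : nat, r < #|F|%:R ^+ n :> R.
  exists (Num.Def.truncn r).+1; apply: lt_trans (truncnS_gt r) _.
  by rewrite -natrX ltr_nat ltn_expl // finNzRing_gt1.
(* Norms of nonzero lattice points are at least gap, which bounds the order
   of vanishing at infinity. *)
have [M MP] : exists M : nat, forall b, I b -> b != 0 -> v (ar_val b) < M.
  have [M MP] := pow_large (cpl_norm Cinf rho / gap).
  exists M => b Ib b0; rewrite ltNge; apply/negP => Mb.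
  have := gap_le b Ib b0; rewrite norm_l // leNgt => /negP; apply.
  rewrite mulrC -ltr_pdivlMr //; apply: le_lt_trans (_ : #|F|%:R ^ (- M%:Z) < _).
    by rewrite ler_eXz2l // lerN2.
  by rewrite -exprnN -[X in _ < X]invrK invf_div ltf_pV2 // posrE ?exprn_gt0 ?divr_gt0.
(* The shift by M makes the filtration start at 0. *)
pose W (n : nat) (b : A) := I b /\ vge v (M%:Z - n%:Z) (ar_val b).
have W_lin n : lin_closed kA (W n).
  split; first by split=> //; left.
  move=> c x y [Ix vx] [Iy vy]; split; first by apply: ID => //; apply: IM.
  exact: (vge_lin v_oo c vx vy).
have [s [s_ind sW s_size]] : exists s : nat -> seq A,
  [/\ forall n, indep kA (s n),
      forall n b, b \in span kA (s n) <-> W n b &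
      forall n d, (size (s (n + d)) <= size (s n) + d)%N].
  apply: filtration_basis => //.
  - move=> b [Ib]; rewrite subr0 => -[b0|Mb]; first exact: val_inj.
    apply/eqP; apply/negPn/negP => b0.
    by have := MP b Ib b0; rewrite ltNge Mb.
  - by move=> n b [Ib vb]; split=> //; apply: vge_mono vb; apply: subz_le_nat.
  move=> n b b' [Ib vb] nWb [Ib' vb'].
  have [Wb'|nWb'] := pselect (W n b').
    by exists 0; rewrite rmorph0 mul0r subr0.
  have exact_val (x : A) : I x -> vge v (M%:Z - n.+1%:Z) (ar_val x) -> ~ W n x ->
      x != 0 /\ v (ar_val x) = M%:Z - n.+1%:Z.
    move=> Ix vx nWx; have x0 : x != 0.
      by apply/eqP => x0; apply: nWx; split=> //; left; rewrite x0.
    split=> //; case: vx => [e|vx]; first by have := arv_neq0 x x0; rewrite e eqxx.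
    apply: subz_squeeze vx _ => le.
    by apply: nWx; split=> //; right.
  have [b0 vbE] := exact_val b Ib vb nWb; have [b0' vbE'] := exact_val b' Ib' vb' nWb'.
  exists (sgn b' / sgn b); split.
    have := ID _ _ Ib' (IM (- kA (sgn b' / sgn b)) b Ib).
    by rewrite mulNr.
  have := leading_coefficient_cancel v_oo w_unif (arv_neq0 b b0) (arv_neq0 b' b0')
    (etrans vbE (esym vbE')) (sgnP b b0) (sgnP b' b0').
  by rewrite vbE subzS.
have s_large r : exists n, forall b, I b -> b \notin span kA (s n) ->
    r < cpl_norm Cinf (rho * jr b).
  have [k kP] := pow_large (r / cpl_norm Cinf rho).
  exists (M + k)%N => b Ib bs.
  have nWb : ~ W (M + k)%N b by move=> /sW bs'; rewrite bs' in bs.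
  have b0 : b != 0.
    by apply/eqP => b0; apply: nWb; split=> //; left; rewrite b0.
  have vb : v (ar_val b) < - k%:Z.
    rewrite ltNge; apply/negP => kv; apply: nWb; split=> //; right.
    by rewrite subzDK.
  rewrite norm_l // mulrC -ltr_pdivrMr //; apply: lt_le_trans kP _.
  by rewrite exprnP ler_eXz2l // lerNr ltW.
(* A power of the uniformizer is small enough to serve as interpolation node. *)
have [M' piP] := pow_large (Num.max 1 gap^-1).
pose pi := embr (w ^+ M').
have norm_pi : cpl_norm Cinf pi = (#|F|%:R ^+ M')^-1.
  case: w_unif => w0 vw.
  by rewrite normE /absK expf_eq0 (negPf w0) andbF (val_exp v_oo) // vw natz -exprnN.
have [pi1 pie] : cpl_norm Cinf pi < 1 /\ cpl_norm Cinf pi < gap.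
  move: piP; rewrite gt_max => /andP[p1 pe]; rewrite norm_pi invf_lt1 ?exprn_gt0 //.
  by split=> //; rewrite -[gap]invrK ltf_pV2 // posrE ?exprn_gt0 ?invr_gt0.
have pi0 : 0 < cpl_norm Cinf pi by rewrite norm_pi invr_gt0 exprn_gt0.
have [phi_size _ phi_lead] := phiP a a0.
(* phi a is nonzero because its coefficient of index deg a is a sign. *)
have [d da] : exists d : nat, v (ar_val a) = - d%:Z.
  apply: size_exponent phi_size.
  rewrite lt0n size_poly_eq0; apply/eqP => phi0.
  have [] := leading_coefficient_val v_oo w_unif (arv_neq0 a a0) (sgnP a a0).
  move: phi_lead; rewrite phi0 coef0 => /esym/eqP.
  by rewrite (fmorph_eq0 embr) fmorph_eq0 => ->.
apply: (@zeta_eigen R F Cinf _ absC complC iota A kA jr j_inj (fun=> erefl) I rho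
  rho_neq0 s s_ind _ _ s_large gap gap_gt0 gap_le _ _ (fun=> erefl) (fun=> erefl) T
  tauV tauVP (completion_root iota) a d (phi a) pi a0 _ pi1 _ _ _ (phi_exp a)).
- by move=> n b /sW [].
- move=> n m nm b /sW [Ib vb]; apply/sW; split=> //; apply: vge_mono vb.
  exact: subz_le_nat.
- by rewrite pi0 pie.
- move=> n b /sW [Ib vb]; apply/sW; split; first exact: IM.
  case: vb => [b0|vb]; first by left; rewrite /= b0 mulr0.
  have [b0|b0] := eqVneq b 0; first by left; rewrite b0 mulr0.
  right; rewrite [ar_val _]/= (val_mul v_oo); [|exact: arv_neq0|exact: arv_neq0].
  by rewrite da; apply: subz_shift.
- by move=> n; apply: s_size.
by apply: size_natz; rewrite phi_size /ar_deg da opprK.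
Qed.
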